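(* Let $n \in \mathbb{N}$ and let $B$ be a maximal lattice-free polytope in $\mathbb{R}^n$. Then the function $f \mapsto \operatorname{vol}(R(B,f)/\mathbb{Z}^n)$, acting from $B$ to $\mathbb{R}$, is the restriction of an affine function.
   Context: A set $B\subseteq\mathbb{R}^n$ is lattice-free if it is $n$-dimensional, closed, convex and $\operatorname{int}(B)\cap\mathbb{Z}^n=\emptyset$; it is maximal lattice-free if it is inclusion-maximal among lattice-free sets. For a maximal lattice-free polytope $B$ and $f\in B$ (not necessarily in the interior), for each face $F$ of $B$ with $F\ne\emptyset$, $F\neq B$ and each $z\in F\cap\mathbb{Z}^n$ put $S_{F,z}(f)=\operatorname{conv}(\{f\}\cup F)\cap\bigl(z+f-\operatorname{conv}(\{f\}\cup F)\bigr)$. The lifting region is $R(B,f)=\bigcup_{F}\bigcup_{z\in F\cap\mathbb{Z}^n}S_{F,z}(f)$, where $F$ ranges over all faces of $B$ other than $\emptyset$ and $B$. For $x\in\mathbb{R}^n$, $[x]$ denotes the vector of componentwise fractional parts ($[t]=t-\lfloor t\rfloor$ for $t \in \mathbb{R}$), and for $X\subseteq\mathbb{R}^n$, $X/\mathbb{Z}^n=\{[x]:x\in X\}\subseteq[0,1]^n$. $\operatorname{vol}$ is $n$-dimensional Lebesgue measure. *)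

(* Defs.v *)
From HB Require Import structures.
From mathcomp Require Import all_boot all_order all_algebra.
From mathcomp Require Import all_classical all_reals all_analysis.

Set Implicit Arguments.
Unset Strict Implicit.
Unset Printing Implicit Defensive.

Import Order.TTheory GRing.Theory Num.Theory.
Import numFieldNormedType.Exports.

Local Open Scope classical_set_scope.
Local Open Scope ring_scope.

Definition cons_tuple (T : Type) n (p : T * n.-tuple T) : n.+1.-tuple T :=
  [tuple of p.1 :: p.2].

Definition uncons_tuple (T : Type) n (t : n.+1.-tuple T) : T * n.-tuple T :=
  (thead t, [tuple of behead t]).

Lemma cons_tupleK T n : cancel (@cons_tuple T n) (@uncons_tuple T n).
Proof. by case=> x t; congr pair; apply/val_inj. Qed.

Lemma measurable_cons_tuple d (T : measurableType d) n :
  measurable_fun setT (@cons_tuple T n).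
Proof. exact: measurable_cons. Qed.

Lemma measurable_uncons_tuple d (T : measurableType d) n :
  measurable_fun setT (@uncons_tuple T n).
Proof.
by apply/measurable_fun_pairP; split;
  [exact: measurable_tnth|exact: measurable_behead].
Qed.

Section cons_measure.
Context d (T : measurableType d) (R : realType) (n : nat).
Variables (m1 : {sigma_finite_measure set T -> \bar R})
          (m2 : {sigma_finite_measure set (n.-tuple T) -> \bar R}).
Local Open Scope ereal_scope.

Definition cons_measure : set (n.+1.-tuple T) -> \bar R :=
  pushforward (m1 \x m2) (@cons_tuple T n).

Let cons_measure0 : cons_measure set0 = 0.
Proof. by rewrite /cons_measure /pushforward preimage_set0 measure0. Qed.

Let cons_measure_ge0 A : 0 <= cons_measure A.
Proof. by rewrite /cons_measure /pushforward; apply: measure_ge0. Qed.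

Let cons_measure_sigma_additive : semi_sigma_additive cons_measure.
Proof.
move=> F mF tF mUF; rewrite /cons_measure /pushforward preimage_bigcup.
have mc A : measurable A -> measurable (@cons_tuple T n @^-1` A).
  by move=> mA; rewrite -[X in measurable X]setTI; exact: measurable_cons_tuple.
apply: measure_semi_sigma_additive; first by move=> k; exact: mc.
  apply/trivIsetP => i j _ _ ij; rewrite -preimage_setI.
  by move/trivIsetP : tF => /(_ _ _ _ _ ij) ->//; rewrite preimage_set0.
by rewrite -preimage_bigcup; exact: mc.
Qed.

HB.instance Definition _ := isMeasure.Build _ _ _ cons_measure
  cons_measure0 cons_measure_ge0 cons_measure_sigma_additive.

Let cons_measure_sigma_finite : sigma_finite setT cons_measure.
Proof.
have /sigma_finiteP[F [FT ndF Foo]] := sigma_finiteT m1.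
have /sigma_finiteP[G [GT ndG Goo]] := sigma_finiteT m2.
exists (fun k => @uncons_tuple T n @^-1` (F k `*` G k)).
  rewrite -preimage_bigcup; apply/esym; rewrite -subTset => t _ /=.
  have [i _ Fi] : (\bigcup_i F i) (thead t) by rewrite -FT.
  have [j _ Gj] : (\bigcup_i G i) [tuple of behead t] by rewrite -GT.
  exists (maxn i j) => //; split => /=.
    by move: Fi; exact/subsetPset/ndF/leq_maxl.
  by move: Gj; exact/subsetPset/ndG/leq_maxr.
move=> k; have [mF Fk] := Foo k; have [mG Gk] := Goo k.
have mFG := measurableX mF mG; split.
  by rewrite -[X in measurable X]setTI; exact: measurable_uncons_tuple.
rewrite /cons_measure /pushforward -comp_preimage.
rewrite (_ : _ \o _ = id); last by apply/funext => p /=; rewrite cons_tupleK.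
by rewrite preimage_id product_measure1E// lte_mul_pinfty// ge0_fin_numE.
Qed.

HB.instance Definition _ := Measure_isSigmaFinite.Build _ _ _ cons_measure
  cons_measure_sigma_finite.

End cons_measure.

Fixpoint lebesgue_tuple (R : realType) (n : nat) :
    {sigma_finite_measure set (n.-tuple (measurableTypeR R)) -> \bar R} :=
  match n with
  | 0 => dirac [tuple]
  | m.+1 => cons_measure lebesgue_measure (lebesgue_tuple R m)
  end.

Lemma lebesgue_tuple_box (R : realType) n
    (A : 'I_n -> set (measurableTypeR R)) :
  (forall i, measurable (A i)) ->
  (lebesgue_tuple R n [set t | forall i, A i (tnth t i)]
   = \prod_(i < n) lebesgue_measure (A i))%E.
Proof.
elim: n A => [|n IH] A mA.
  by rewrite big_ord0 /= diracE mem_set//; case.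
rewrite big_ord_recl -IH// -product_measure1E//; last first.
  rewrite [X in measurable X](_ : _ =
      \bigcap_(i in [set: 'I_n]) (@tnth _ (measurableTypeR R) ^~ i) @^-1` A (lift ord0 i)).
    apply: fin_bigcap_measurable; first exact: finite_finset.
    by move=> i _; rewrite -[X in measurable X]setTI; exact: measurable_tnth.
  by apply/seteqP; split => [t At i _|t At i]; exact: At.
rewrite /= /cons_measure /pushforward; congr product_measure1.
apply/seteqP; split => -[x t] /=.
  by move=> At; split=> [|i]; [have := At ord0|have := At (lift ord0 i); rewrite tnthS].
by move=> [Ax At] i; case: (unliftP ord0 i) => [j ->|-> //]; rewrite tnthS.
Qed.

(* Coordinates are read off as a tuple because MathComp-Analysis equips tuples,
   not row vectors, with the product (Borel) sigma-algebra. *)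
Definition vol (R : realType) n (A : set 'rV[R]_n) : \bar R :=
  lebesgue_tuple R n [set t | A (\row_i tnth t i)].

Section LiftingRegion.
Context {R : realType} {n : nat}.
Implicit Types (A B F X : set 'rV[R]_n) (x y z f : 'rV[R]_n).

Definition conv A : set 'rV[R]_n := smallest (@convex_set R 'rV[R]_n) A.

Definition polytope A := exists s : seq 'rV[R]_n, A = conv [set` s].

Definition affine_set A :=
  forall x y (t : R), A x -> A y -> A ((1 - t) *: x + t *: y).

Definition affine_hull A : set 'rV[R]_n := smallest affine_set A.

(* The only n-dimensional affine subspace of R^n is R^n itself. *)
Definition full_dimensional A := affine_hull A = setT.

Definition lattice : set 'rV[R]_n := [set z | forall i, z 0 i \is a Num.int].

Definition lattice_free B :=
  [/\ full_dimensional B, closed B, convex_set B & interior B `&` lattice = set0].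

Definition maximal_lattice_free B :=
  lattice_free B /\ forall C, lattice_free C -> B `<=` C -> C = B.

Definition dotp x y : R := \sum_(i < n) x 0 i * y 0 i.

(* a = 0 is allowed, so set0 and B are faces of B. *)
Definition face B F := exists (a : 'rV[R]_n) (b : R),
  (forall x, B x -> dotp a x <= b) /\ F = B `&` [set x | dotp a x = b].

Definition spindle f F z : set 'rV[R]_n :=
  conv (f |` F) `&` [set z + f - y | y in conv (f |` F)].

Definition lifting_region B f : set 'rV[R]_n :=
  \bigcup_(F in [set F | [/\ face B F, F <> set0 & F <> B]])
    \bigcup_(z in F `&` lattice) spindle f F z.

Definition frac_part x : 'rV[R]_n := \row_i (x 0 i - (Num.floor (x 0 i))%:~R).

Definition mod_lattice X : set 'rV[R]_n := frac_part @` X.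

Definition affine_function (g : 'rV[R]_n -> R) :=
  exists (a : 'rV[R]_n) (c : R), forall x, g x = dotp a x + c.

End LiftingRegion.

(* Main.v *)
From HB Require Import structures.
From mathcomp Require Import all_boot all_order all_algebra.
From mathcomp Require Import all_classical all_reals all_analysis.
From mathcomp Require Import measurable_realfun ring lra zify.
Require Import Defs.

(** A spindle [S_{F,z}(f)] is sliced by the height over the apex [f]: put [f] at
    height 0 and the face [F] at height 1.  Its slice at height [t] is the
    translate by [(1 - t) f] of the intersection of [t F] with [z - (1 - t) F],
    a set that no longer depends on [f].  So moving the apex from [f] to [f']
    moves every point of height [t] by [(1 - t) (f' - f)] ([spin_move]); on the
    spindles over [F] this is an affine map fixing the hyperplane of [F]
    ([apex_map]), and its determinant is the ratio of the distances of [f'] and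
    [f] to that hyperplane ([scales_vol_apex_map]), which is affine in [f'].

    These maps for the various faces are compatible modulo the lattice because
    two points of the region that differ by a lattice vector have the same
    height ([spin_collision]): from a pair with different heights one builds a
    lattice point which is a convex combination of points of [B] giving positive
    weight to a point of the interior, contradicting lattice-freeness.

    So fix a reference apex [f0] in the interior of [B] and cut the region of
    [f0] modulo the lattice into finitely many disjoint pieces, each coming from
    one translated spindle.  For any [f] in [B] the moved pieces are still
    disjoint modulo the lattice and cover the region of [f], up to null sets.
    Hence the volume for [f] is a sum of constants times the distances of [f] to
    the hyperplanes of the faces, an affine function of [f].

    Two null sets have to be discarded when [f] is on the boundary of [B]: the
    faces containing [f], whose spindles are flat and whose coefficient vanishes,
    and the points where the interior point needed in the collision argument is
    only a boundary point; the latter are null since the boundary of [B] is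
    ([vol_boundary]).

    On the measure side, a map changing one coordinate [x_i] into
    [d x_i + phi(x)], where [phi] ignores [x_i], multiplies volumes by [|d|]
    by Fubini ([lebesgue_tuple_coord_map]), and translations, homotheties and
    the maps [apex_map] are compositions of such maps. *)

Set Implicit Arguments.
Unset Strict Implicit.
Unset Printing Implicit Defensive.

Import Order.TTheory GRing.Theory Num.Theory.
Import numFieldNormedType.Exports.

Local Open Scope classical_set_scope.
Local Open Scope ring_scope.

(** * Volume under changes of one coordinate *)

Lemma lebesgue_measure_affine_preimage (R : realType) (d c : R)
    (A : set (measurableTypeR R)) : d != 0 -> measurable A ->
  lebesgue_measure ((fun x : R => d * x + c) @^-1` A) =
  (`|d^-1|%:E * lebesgue_measure A)%E.
Proof.
move=> d0 mA.
pose f : measurableTypeR R -> measurableTypeR R := fun x : R => d * x + c.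
have mf : measurable_fun setT f.
  by apply: measurable_funD => //; apply: measurable_funM.
have E : forall X, ocitv X ->
    (lebesgue_measure X = `|d|%:E * lebesgue_measure (f @^-1` X))%E.
  move=> _ [[a b] _ <-] /=.
  have := d0; rewrite neq_lt => /orP[dn|dp].
    have -> : f @^-1` `]a, b]%classic = `[(b - c) / d, (a - c) / d[%classic.
      apply/seteqP; split => x /=; rewrite !in_itv /= /f => /andP[h1 h2];
      apply/andP; split.
      - by rewrite ler_ndivrMr// [x * d]mulrC; lra.
      - by rewrite ltr_ndivlMr// [x * d]mulrC; lra.
      - by move: h2; rewrite ltr_ndivlMr// [x * d]mulrC; lra.
      - by move: h1; rewrite ler_ndivrMr// [x * d]mulrC; lra.
    rewrite !lebesgue_measure_itv/= !lte_fin ltr_ndivrMr// divfK// ltrBlDr subrK.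
    case: ifPn => ab; last by rewrite mule0.
    by rewrite ltr0_norm// -!EFinB -EFinM; congr (_%:E); field.
  have -> : f @^-1` `]a, b]%classic = `](a - c) / d, (b - c) / d]%classic.
    apply/seteqP; split => x /=; rewrite !in_itv /= /f => /andP[h1 h2];
    apply/andP; split.
    - by rewrite ltr_pdivrMr// [x * d]mulrC; lra.
    - by rewrite ler_pdivlMr// [x * d]mulrC; lra.
    - by move: h1; rewrite ltr_pdivrMr// [x * d]mulrC; lra.
    - by move: h2; rewrite ler_pdivlMr// [x * d]mulrC; lra.
  rewrite !lebesgue_measure_itv/= !lte_fin ltr_pdivrMr// divfK// ltrBlDr subrK.
  case: ifPn => ab; last by rewrite mule0.
  by rewrite gtr0_norm// -!EFinB -EFinM; congr (_%:E); field.
have nd0 : (0 <= `|d|)%R by [].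
pose nu : {measure set (measurableTypeR R) -> \bar R} :=
  pushforward lebesgue_measure f.
pose mu : {measure set (measurableTypeR R) -> \bar R} :=
  mscale (NngNum nd0) (nu mf).
have -> : lebesgue_measure A = mu A by exact: lebesgue_measure_unique.
rewrite /mu /= /mscale /pushforward /=.
by rewrite muleA -EFinM -normrM mulVf// normr1 mul1e.
Qed.

Section coordinate_change.
Context {R : realType}.
Local Notation T := (measurableTypeR R).

Definition upd n (i : 'I_n) (y : T) (t : n.-tuple T) : n.-tuple T :=
  [tuple (if j == i then y else tnth t j) | j < n].

Lemma tnth_upd n (i j : 'I_n) (y : T) t :
  tnth (upd i y t) j = if j == i then y else tnth t j.
Proof. by rewrite tnth_mktuple. Qed.

Definition coord_map n (i : 'I_n) (d : R) (phi : n.-tuple T -> T) t :=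
  upd i (d * tnth t i + phi t) t.

Lemma measurable_coord_map n (i : 'I_n) d phi :
  measurable_fun setT phi -> measurable_fun setT (coord_map i d phi).
Proof.
move=> mphi; apply/measurable_fun_tnthP => j; rewrite /comp /=.
have [->|ji] := eqVneq j i.
  under eq_fun do rewrite tnth_upd eqxx.
  apply: measurable_funD => //; apply: measurable_funM => //.
  exact: measurable_tnth.
under eq_fun do rewrite tnth_upd (negbTE ji).
exact: measurable_tnth.
Qed.

Lemma product_measure12 d1 d2 (T1 : measurableType d1) (T2 : measurableType d2)
    (m1 : {sigma_finite_measure set T1 -> \bar R})
    (m2 : {sigma_finite_measure set T2 -> \bar R}) X : measurable X ->
  ((m1 \x m2) X = (m1 \x^ m2) X)%E.
Proof.
apply: product_measure_unique => A B mA mB.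
exact: product_measure2E.
Qed.

(** Fubini: if [i] is the first coordinate, each line in that direction undergoes
    an affine map of slope [d]; otherwise each hyperplane of constant first
    coordinate undergoes a map of the same kind in one dimension less. *)
Lemma lebesgue_tuple_coord_map n (i : 'I_n) (d : R) (phi : n.-tuple T -> T)
    (Y : set (n.-tuple T)) :
  d != 0 -> measurable_fun setT phi ->
  (forall y t, phi (upd i y t) = phi t) -> measurable Y ->
  (lebesgue_tuple R n (coord_map i d phi @^-1` Y) =
   `|d^-1|%:E * lebesgue_tuple R n Y)%E.
Proof.
move=> d0; elim: n i phi Y => [[]//|n IH] i phi Y mphi hphi mY.
have mcons A : measurable A -> measurable (@cons_tuple T n @^-1` A).
  by move=> mA; rewrite -[X in measurable X]setTI; exact: measurable_cons_tuple.
set W := @cons_tuple T n @^-1` Y.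
have mW : measurable W by exact: mcons.
have mpre : measurable (coord_map i d phi @^-1` Y).
  by rewrite -[X in measurable X]setTI; exact: measurable_coord_map.
rewrite /= /cons_measure /pushforward -/W.
case: (unliftP ord0 i) => [j ij|i0].
  rewrite /product_measure1 -ge0_integralZl//; last first.
    exact: measurable_fun_xsection.
  apply: eq_integral => x _ /=.
  have mphix : measurable_fun setT (fun t => phi (cons_tuple (x, t))).
    apply: measurableT_comp => //.
    apply: (measurableT_comp (@measurable_cons_tuple _ T n)).
    exact: pair1_measurable.
  have mWx := measurable_xsection x mW.
  rewrite -(IH j (fun t => phi (cons_tuple (x, t))) _ mphix _ mWx).
    have key t : cons_tuple (x, coord_map j d (fun t => phi (cons_tuple (x, t))) t)
        = coord_map i d phi (cons_tuple (x, t)).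
      apply: eq_from_tnth => k; rewrite /coord_map !tnth_upd.
      case: (unliftP ord0 k) => [l ->|->]; last by rewrite ij.
      by rewrite /= !tnthS !tnth_upd ij (inj_eq lift_inj) !tnthS.
    congr (lebesgue_tuple R n _); apply/seteqP; split => t.
      by move=> /xsectionP h; apply/xsectionP; rewrite /W /= key.
    by move=> /xsectionP h; apply/xsectionP; move: h; rewrite /W /= key.
  move=> y t; rewrite -[RHS](hphi y); congr (phi _).
  apply: eq_from_tnth => k; rewrite !tnth_upd.
  case: (unliftP ord0 k) => [l ->|->]; last by rewrite ij.
  by rewrite /= !tnthS !tnth_upd ij (inj_eq lift_inj).
rewrite product_measure12; last exact: mcons.
rewrite product_measure12//.
rewrite /product_measure2 -ge0_integralZl//; last first.
  exact: measurable_fun_ysection.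
apply: eq_integral => t _ /=.
rewrite -(@lebesgue_measure_affine_preimage _ d (phi (cons_tuple (0, t))))//;
  last exact: measurable_ysection.
have key x : cons_tuple (d * x + phi (cons_tuple (0, t)), t) =
    coord_map i d phi (cons_tuple (x, t)).
  apply: eq_from_tnth => k; rewrite /coord_map !tnth_upd.
  case: (unliftP ord0 k) => [l ->|->]; rewrite i0 /= ?tnthS//.
  congr (_ + _); rewrite -[LHS](hphi x); congr (phi _).
  apply: eq_from_tnth => l; rewrite tnth_upd i0.
  by case: (unliftP ord0 l) => [l' ->|->//]; rewrite /= !tnthS.
congr (lebesgue_measure _); apply/seteqP; split => x.
  by move=> /ysectionP h; apply/ysectionP; rewrite /W /= key.
by move=> /ysectionP h; apply/ysectionP; move: h; rewrite /W /= key.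
Qed.

End coordinate_change.

(** * Volume of sets of row vectors *)

Section row_vectors.
Context {R : realType} {n : nat}.
Local Notation T := (measurableTypeR R).
Implicit Types (A B Y : set 'rV[R]_n) (a x y v w : 'rV[R]_n).

Definition row_of_tuple (t : n.-tuple T) : 'rV[R]_n := \row_i tnth t i.

Definition mset A := measurable (row_of_tuple @^-1` A).

Definition mfun (h : 'rV[R]_n -> T) := measurable_fun setT (h \o row_of_tuple).

Lemma volE A : vol A = lebesgue_tuple R n (row_of_tuple @^-1` A).
Proof. by []. Qed.

Lemma mset0 : mset set0.
Proof. by rewrite /mset preimage_set0. Qed.

Lemma msetI A B : mset A -> mset B -> mset (A `&` B).
Proof. exact: measurableI. Qed.

Lemma msetU A B : mset A -> mset B -> mset (A `|` B).
Proof. exact: measurableU. Qed.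

Lemma msetD A B : mset A -> mset B -> mset (A `\` B).
Proof. exact: measurableD. Qed.

Lemma mset_bigcup_seq (I : choiceType) (s : seq I) (F : I -> set 'rV[R]_n) :
  (forall i, i \in s -> mset (F i)) -> mset (\bigcup_(i in [set` s]) F i).
Proof.
move=> mF; rewrite /mset preimage_bigcup; exact: fin_bigcup_measurable.
Qed.

Lemma mfun_coord i : mfun (fun x => x 0 i).
Proof.
rewrite /mfun (_ : _ \o _ = (@tnth n T)^~ i); first exact: measurable_tnth.
by apply/funext => t; rewrite /= mxE.
Qed.

Lemma mfun_cst (c : R) : mfun (fun=> c).
Proof. exact: measurable_cst. Qed.

Lemma mfunD h k : mfun h -> mfun k -> mfun (fun x => h x + k x : R).
Proof. exact: measurable_funD. Qed.

Lemma mfunM h k : mfun h -> mfun k -> mfun (fun x => h x * k x : R).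
Proof. exact: measurable_funM. Qed.

Lemma mfunB h k : mfun h -> mfun k -> mfun (fun x => h x - k x : R).
Proof. exact: measurable_funB. Qed.

Lemma mfun_sum (I : eqType) (s : seq I) (P : pred I) (h : I -> 'rV[R]_n -> T) :
  (forall i, mfun (h i)) -> mfun (fun x => \sum_(i <- s | P i) h i x : R).
Proof.
move=> mh; elim: s => [|i s IH].
  by rewrite (_ : (fun _ => _) = fun=> 0); [exact: mfun_cst|
    apply/funext => x; rewrite big_nil].
case Pi: (P i); last first.
  rewrite (_ : (fun _ => _) = fun x => \sum_(i <- s | P i) h i x : R)//.
  by apply/funext => x; rewrite big_cons Pi.
rewrite (_ : (fun _ => _) = fun x => h i x + \sum_(i <- s | P i) h i x : R).
  exact: mfunD.
by apply/funext => x; rewrite big_cons Pi.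
Qed.

Lemma mfun_dotp a : mfun (fun x => dotp a x).
Proof.
apply: mfun_sum => i; apply: mfunM; [exact: mfun_cst|exact: mfun_coord].
Qed.

Lemma mset_preimage_fun h (A : set T) : mfun h -> measurable A ->
  mset (h @^-1` A).
Proof. by move=> mh mA; rewrite /mset -[X in measurable X]setTI; exact: mh. Qed.

(** An open set is the union of the boxes with rational corners it contains. *)
Lemma mset_open A : open A -> mset A.
Proof.
move=> oA; rewrite /mset.
pose box (p : n.-tuple (rat * rat)) : set (n.-tuple T) :=
  [set t | forall i, `](ratr (tnth p i).1 : R), ratr (tnth p i).2[%classic (tnth t i)].
have mbox p : measurable (box p).
  rewrite (_ : box p = \bigcap_(i in [set: 'I_n])
      (@tnth n T)^~ i @^-1` `](ratr (tnth p i).1 : R), ratr (tnth p i).2[%classic).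
    apply: fin_bigcap_measurable; first exact: finite_finset.
    by move=> i _; rewrite -[X in measurable X]setTI; exact: measurable_tnth.
  by apply/seteqP; split => [t h i _|t h i]; exact: h.
rewrite (_ : _ @^-1` _ = \bigcup_(p in [set p | box p `<=` row_of_tuple @^-1` A]) box p).
  rewrite bigcup_mkcond.
  apply: countable_bigcupT_measurable => [|p]; first exact: countableP.
  by case: ifP.
apply/seteqP; split => t; last by move=> [p hp /hp].
move=> At; have /nbhs_ballP[e /= e0 he] := open_nbhs_nbhs (conj oA At).
have q1 i : exists q : rat, (tnth t i - e < ratr q < tnth t i)%R.
  have [|q] := @rat_in_itvoo R (tnth t i - e) (tnth t i).
    by rewrite ltrBlDr ltrDl.
  by rewrite in_itv /= => hq; exists q.
have q2 i : exists q : rat, (tnth t i < ratr q < tnth t i + e)%R.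
  have [|q] := @rat_in_itvoo R (tnth t i) (tnth t i + e).
    by rewrite ltrDl.
  by rewrite in_itv /= => hq; exists q.
exists [tuple (sval (cid (q1 i)), sval (cid (q2 i))) | i < n].
  move=> u /= hu; apply: he; split=> // j i; rewrite [j]ord1 !mxE.
  have := hu i; rewrite tnth_mktuple /= in_itv /=.
  case: (cid (q1 i)) => /= q /andP[a1 a2]; case: (cid (q2 i)) => /= r /andP[a3 a4].
  move=> /andP[a5 a6]; rewrite /ball /= ltr_norml; apply/andP; split; lra.
move=> i; rewrite tnth_mktuple /= in_itv /=.
case: (cid (q1 i)) => /= q /andP[a1 a2]; case: (cid (q2 i)) => /= r /andP[a3 a4].
by rewrite a2 a3.
Qed.

Lemma mset_closed A : closed A -> mset A.
Proof.
move=> /closed_openC/mset_open/measurableC.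
by rewrite -preimage_setC setCK.
Qed.

(** [k] plays the part of the inverse of the absolute Jacobian determinant of
    [g]: preimages are measurable without any study of images. *)
Definition scales_vol (g : 'rV[R]_n -> 'rV[R]_n) (k : R) :=
  (forall Y, mset Y -> mset (g @^-1` Y)) /\
  (forall Y, mset Y -> vol (g @^-1` Y) = (k%:E * vol Y)%E).

Lemma scales_vol_id : scales_vol id 1.
Proof. by split => // Y _; rewrite mul1e. Qed.

Lemma scales_vol_comp f g k l :
  scales_vol f k -> scales_vol g l -> scales_vol (f \o g) (k * l).
Proof.
move=> [f1 f2] [g1 g2]; split=> Y mY; first exact: g1 _ (f1 _ mY).
rewrite (_ : _ @^-1` Y = g @^-1` (f @^-1` Y))//.
by rewrite g2 ?f2//; [rewrite muleA mulrC|exact: f1].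
Qed.

Definition row_coord_map (i : 'I_n) (d : R) (phi : 'rV[R]_n -> R) x : 'rV[R]_n :=
  \row_j if j == i then d * x 0 i + phi x else x 0 j.

Lemma scales_vol_coord_map i d phi : d != 0 -> mfun phi ->
  (forall x y, (forall k, k != i -> x 0 k = y 0 k) -> phi x = phi y) ->
  scales_vol (row_coord_map i d phi) `|d^-1|.
Proof.
move=> d0 mphi hphi.
have E t : row_coord_map i d phi (row_of_tuple t) =
    row_of_tuple (coord_map i d (phi \o row_of_tuple) t).
  by apply/rowP => j; rewrite !mxE tnth_upd.
have E' Y : row_of_tuple @^-1` (row_coord_map i d phi @^-1` Y) =
    coord_map i d (phi \o row_of_tuple) @^-1` (row_of_tuple @^-1` Y).
  by apply/seteqP; split => t /=; rewrite E.
split=> Y mY; rewrite ?volE /mset E'.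
  by rewrite -[X in measurable X]setTI; exact: measurable_coord_map.
apply: lebesgue_tuple_coord_map => // y t /=; apply: hphi => k ki.
by rewrite !mxE tnth_upd (negbTE ki).
Qed.

Definition row_coords_map (s : seq 'I_n) (d : 'I_n -> R)
    (phi : 'I_n -> 'rV[R]_n -> R) x : 'rV[R]_n :=
  \row_j if j \in s then d j * x 0 j + phi j x else x 0 j.

(** The new coordinates on [s] only involve old coordinates off [s], so they
    can be installed one at a time. *)
Lemma scales_vol_coords_map s d phi : uniq s -> (forall j, d j != 0) ->
  (forall j, mfun (phi j)) ->
  (forall j x y, (forall k, k \notin s -> x 0 k = y 0 k) -> phi j x = phi j y) ->
  scales_vol (row_coords_map s d phi) (\prod_(j <- s) `|(d j)^-1|).
Proof.
move=> us d0 mphi; elim: s us => [_ _|i s IH /= /andP[is_ us] hphi].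
  rewrite big_nil (_ : row_coords_map _ _ _ = id); first exact: scales_vol_id.
  by apply/funext => x; apply/rowP => j; rewrite mxE.
rewrite big_cons (_ : row_coords_map _ _ _ =
    row_coord_map i (d i) (phi i) \o row_coords_map s d phi).
  apply: scales_vol_comp.
    apply: scales_vol_coord_map => // x y h; apply: hphi => k.
    by rewrite inE negb_or => /andP[/h].
  apply: IH => // j x y h; apply: hphi => k.
  by rewrite inE negb_or => /andP[_ /h].
apply/funext => x; apply/rowP => j; rewrite /= !mxE inE.
have [->/=|//] := eqVneq j i; rewrite (negbTE is_); congr (_ + _).
apply: hphi => k; rewrite inE negb_or mxE => /andP[_ /negbTE ->].
by [].
Qed.

Lemma scales_vol_translation w : scales_vol (fun x => x + w) 1.
Proof.
rewrite (_ : (fun _ => _) =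
    row_coords_map (enum 'I_n) (fun=> 1) (fun j _ => w 0 j)); last first.
  by apply/funext => x; apply/rowP => j; rewrite !mxE mem_enum mul1r.
rewrite [X in scales_vol _ X](_ : _ = \prod_(j <- enum 'I_n) `|1^-1|).
  apply: scales_vol_coords_map => // [|j]; first exact: enum_uniq.
  exact: mfun_cst.
by rewrite big1// => i _; rewrite invr1 normr1.
Qed.

Lemma scales_vol_homothety (l : R) : l != 0 ->
  scales_vol (fun x => l *: x) (`|l^-1| ^+ n).
Proof.
move=> l0; rewrite (_ : (fun _ => _) =
    row_coords_map (enum 'I_n) (fun=> l) (fun j _ => 0)); last first.
  by apply/funext => x; apply/rowP => j; rewrite !mxE mem_enum addr0.
rewrite [X in scales_vol _ X](_ : _ = \prod_(j <- enum 'I_n) `|l^-1|).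
  apply: scales_vol_coords_map => //; first exact: enum_uniq.
  by move=> j; exact: mfun_cst.
by rewrite big_enum /= prodr_const card_ord.
Qed.

Lemma dotpD1 i a x : dotp a x = a 0 i * x 0 i + \sum_(k | k != i) a 0 k * x 0 k.
Proof. by rewrite /dotp (bigD1 i). Qed.

Lemma mfun_partial_dotp (i : 'I_n) a :
  mfun (fun x => \sum_(k | k != i) a 0 k * x 0 k).
Proof.
by apply: mfun_sum => k; apply: mfunM; [exact: mfun_cst|exact: mfun_coord].
Qed.

Lemma scales_vol_dotp_coord i a : a 0 i != 0 ->
  scales_vol (row_coord_map i (a 0 i) (fun x => \sum_(k | k != i) a 0 k * x 0 k))
    `|(a 0 i)^-1|.
Proof.
move=> ai; apply: scales_vol_coord_map => //; first exact: mfun_partial_dotp.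
by move=> x y h; apply: eq_bigr => k /h ->.
Qed.

(** Taking [dotp a x] as [i]-th coordinate turns the map into a scaling of that
    coordinate and translations of the other ones by amounts depending on it. *)
Lemma scales_vol_rank_one a v (c : R) i : a 0 i != 0 -> 1 - dotp a v != 0 ->
  scales_vol (fun x => x + (c - dotp a x) *: v) `|(1 - dotp a v)^-1|.
Proof.
move=> ai0 s0; set s := dotp a v in s0 *.
(* [P] makes [dotp a x] the [i]-th coordinate and [P'] undoes it; [Q] adds
   [(c - dotp a x) * v] to the other coordinates, [S] corrects the [i]-th. *)
pose P := row_coord_map i (a 0 i) (fun x => \sum_(k | k != i) a 0 k * x 0 k).
pose Q := row_coords_map (rem i (enum 'I_n)) (fun=> 1)
  (fun j x => (c - x 0 i) * v 0 j).
pose S := row_coord_map i (1 - s) (fun=> c * s).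
pose P' := row_coord_map i (a 0 i)^-1
  (fun x => - (a 0 i)^-1 * \sum_(k | k != i) a 0 k * x 0 k).
have sP : scales_vol P `|(a 0 i)^-1| by exact: scales_vol_dotp_coord.
have ue := enum_uniq 'I_n.
have sQ : scales_vol Q 1.
  rewrite [X in scales_vol _ X](_ : _ =
      \prod_(j <- rem i (enum 'I_n)) `|1^-1|).
    apply: scales_vol_coords_map => [|_|j|j x y h]; first exact: rem_uniq.
    - exact: oner_neq0.
    - apply: mfunM; last exact: mfun_cst.
      by apply: mfunB; [exact: mfun_cst|exact: mfun_coord].
    - by rewrite h// mem_rem_uniq// !inE eqxx.
  by rewrite big1// => j _; rewrite invr1 normr1.
have sS : scales_vol S `|(1 - s)^-1|.
  by apply: scales_vol_coord_map => //; exact: mfun_cst.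
have sP' : scales_vol P' `|a 0 i|.
  rewrite -[X in `|X|]invrK; apply: scales_vol_coord_map.
  - by rewrite invr_neq0.
  - by apply: mfunM; [exact: mfun_cst|exact: mfun_partial_dotp].
  - by move=> x y h; congr (_ * _); apply: eq_bigr => k /h ->.
have := scales_vol_comp sP' (scales_vol_comp sS (scales_vol_comp sQ sP)).
rewrite mul1r mulrCA -normrM divff// normr1 mulr1.
congr (scales_vol _ _); apply/funext => x; apply/rowP => j /=.
have Pi : P x 0 i = dotp a x by rewrite mxE eqxx (dotpD1 i).
have Pk k : k != i -> P x 0 k = x 0 k by move=> ki; rewrite mxE (negbTE ki).
have Qi : Q (P x) 0 i = dotp a x.
  by rewrite mxE mem_rem_uniq// !inE eqxx /= Pi.
have Qk k : k != i -> Q (P x) 0 k = x 0 k + (c - dotp a x) * v 0 k.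
  by move=> ki; rewrite mxE mem_rem_uniq// !inE ki mem_enum /= Pi Pk// mul1r.
have Si : S (Q (P x)) 0 i = (1 - s) * dotp a x + c * s by rewrite mxE eqxx Qi.
have Sk k : k != i -> S (Q (P x)) 0 k = x 0 k + (c - dotp a x) * v 0 k.
  by move=> ki; rewrite mxE (negbTE ki) Qk.
have -> : (x + (c - dotp a x) *: v) 0 j = x 0 j + (c - dotp a x) * v 0 j.
  by rewrite !mxE.
rewrite [LHS]mxE; have [->|ji] := eqVneq j i; last by rewrite Sk.
rewrite Si; under eq_bigr => k ki do rewrite Sk// mulrDr mulrCA.
rewrite big_split /= -mulr_sumr.
have := dotpD1 i a x; have := dotpD1 i a v; rewrite -/s.
set A1 := \sum_(_ | _) _; set A2 := \sum_(_ | _) _ => -> ->.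
by field.
Qed.

Lemma vol_hyperplane_coord i (b : R) : vol [set x : 'rV[R]_n | x 0 i = b] = 0%E.
Proof.
pose A j : set T := if j == i then [set b] else setT.
rewrite volE (_ : _ @^-1` _ = [set t | forall j, A j (tnth t j)]).
  rewrite lebesgue_tuple_box; last by move=> j; rewrite /A; case: ifP.
  by rewrite (bigD1 i)//= /A eqxx lebesgue_measure_set1 mul0e.
apply/seteqP; split => t; rewrite /= ?mxE /A.
  by move=> h j; have [->|] := eqVneq j i.
by move=> /(_ i); rewrite eqxx.
Qed.

Lemma mset_hyperplane a (b : R) : mset [set x | dotp a x = b].
Proof.
exact: (@mset_preimage_fun (fun x => dotp a x) [set b] (mfun_dotp a)).
Qed.

(** The hyperplane becomes a coordinate hyperplane once [dotp a x] is a
    coordinate. *)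
Lemma vol_hyperplane a (b : R) : a != 0 -> vol [set x | dotp a x = b] = 0%E.
Proof.
move=> a0; have [i ai] : exists i, a 0 i != 0.
  apply/existsP; rewrite -negb_forall; apply: contra a0 => /forallP h.
  by apply/eqP/rowP => i; rewrite mxE; exact/eqP.
have [_ sP] := scales_vol_dotp_coord ai.
rewrite (_ : [set x | _] = row_coord_map i (a 0 i)
    (fun x => \sum_(k | k != i) a 0 k * x 0 k) @^-1` [set x | x 0 i = b]).
  rewrite sP ?vol_hyperplane_coord ?mule0//.
  exact: (@mset_preimage_fun (fun x => x 0 i) [set b] (mfun_coord i)).
by apply/seteqP; split => x; rewrite /= mxE eqxx (dotpD1 i).
Qed.

Lemma le_vol A B : mset A -> mset B -> A `<=` B -> (vol A <= vol B)%E.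
Proof.
by move=> mA mB AB; apply: le_measure; rewrite ?inE//; exact: preimage_subset.
Qed.

Lemma vol_null_subset A B : mset A -> mset B -> A `<=` B -> vol B = 0%E ->
  vol A = 0%E.
Proof.
move=> mA mB AB B0; apply/eqP; rewrite eq_le measure_ge0 andbT -B0.
exact: le_vol.
Qed.

Lemma vol_bounded_fin A (M : R) : mset A -> (forall x i, A x -> `|x 0 i| <= M) ->
  (vol A < +oo)%E.
Proof.
move=> mA hA; pose I (_ : 'I_n) : set T := `[- M, M]%classic.
have mI i : measurable (I i) by exact: measurable_itv.
apply: (@le_lt_trans _ _ (lebesgue_tuple R n [set t | forall i, I i (tnth t i)])).
  apply: le_measure; rewrite ?inE//.
    rewrite (_ : [set _ | _] = \bigcap_(i in [set: 'I_n]) (@tnth n T)^~ i @^-1` I i).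
      apply: fin_bigcap_measurable; first exact: finite_finset.
      by move=> i _; rewrite -[X in measurable X]setTI; exact: measurable_tnth.
    by apply/seteqP; split => [t h i _|t h i]; exact: h.
  move=> t /= At i; rewrite /I /= in_itv /= -ler_norml.
  by have := hA _ i At; rewrite mxE.
rewrite lebesgue_tuple_box//.
suff /andP[] : ((0 <= \prod_(i < n) lebesgue_measure (I i)) &&
  (\prod_(i < n) lebesgue_measure (I i) < +oo))%E by [].
elim/big_rec: _ => [|i x _ /andP[x0 xy]]; first by rewrite lee01 ltry.
rewrite mule_ge0 ?measure_ge0//= lte_mul_pinfty ?measure_ge0//.
rewrite /I lebesgue_measure_itv /=; case: ifP => _ //.
Qed.

End row_vectors.

(** * Convex hulls, faces and polytopes *)

Section convex_geometry.
Context {R : realType} {n : nat}.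
Implicit Types (A B C F : set 'rV[R]_n) (a f q r x y z v w : 'rV[R]_n)
  (p : 'rV[R]_n * R).

Lemma dotpDr a x y : dotp a (x + y) = dotp a x + dotp a y.
Proof. by rewrite -big_split /=; apply: eq_bigr => i _; rewrite mxE mulrDr. Qed.

Lemma dotpZr a (k : R) x : dotp a (k *: x) = k * dotp a x.
Proof. by rewrite mulr_sumr; apply: eq_bigr => i _; rewrite mxE mulrCA. Qed.

Lemma dotpBr a x y : dotp a (x - y) = dotp a x - dotp a y.
Proof. by rewrite dotpDr -scaleN1r dotpZr mulN1r. Qed.

Lemma dotpC x y : dotp x y = dotp y x.
Proof. by apply: eq_bigr => i _; rewrite mulrC. Qed.

Lemma convex_setP A : convex_set (A : set (convex_lmodType 'rV[R]_n)) <->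
  (forall x y (t : R), 0 <= t -> t <= 1 -> A x -> A y -> A ((1 - t) *: x + t *: y)).
Proof.
split=> [cA x y t t0 t1 Ax Ay|h].
  have := cA y x (Itv01 t0 t1); rewrite !inE => /(_ Ay Ax) cAyx.
  by rewrite addrC; exact: cAyx.
move=> x y k; rewrite !inE => Ax Ay.
by have := h y x k%:num (ge0 k) (le1 k) Ay Ax; rewrite addrC => hk; exact: hk.
Qed.

Lemma sub_conv A : A `<=` conv A.
Proof. exact: sub_gen_smallest. Qed.

Lemma conv_min A C : convex_set (C : set (convex_lmodType 'rV[R]_n)) ->
  A `<=` C -> conv A `<=` C.
Proof. by move=> cC AC; exact: smallest_sub. Qed.

Lemma convex_conv A : convex_set (conv A : set (convex_lmodType 'rV[R]_n)).
Proof.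
apply/convex_setP => x y t t0 t1 Ax Ay C [cC AC].
by move/convex_setP : (cC); apply => //; [exact: Ax|exact: Ay].
Qed.

Lemma convex_setI A B : convex_set (A : set (convex_lmodType 'rV[R]_n)) ->
  convex_set (B : set (convex_lmodType 'rV[R]_n)) ->
  convex_set (A `&` B : set (convex_lmodType 'rV[R]_n)).
Proof.
move=> /convex_setP cA /convex_setP cB; apply/convex_setP.
by move=> x y t t0 t1 [Ax Bx] [Ay By]; split; [exact: cA|exact: cB].
Qed.

Lemma dotp_conv a x y (t : R) :
  dotp a ((1 - t) *: x + t *: y) = (1 - t) * dotp a x + t * dotp a y.
Proof. by rewrite dotpDr !dotpZr. Qed.

Lemma convex_hyperplane a (b : R) :
  convex_set ([set x | dotp a x = b] : set (convex_lmodType 'rV[R]_n)).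
Proof.
apply/convex_setP => x y t t0 t1 /= hx hy.
by rewrite dotp_conv hx hy; ring.
Qed.

Definition exposed B (p : 'rV[R]_n * R) := B `&` [set x | dotp p.1 x = p.2].

Definition supports B (p : 'rV[R]_n * R) := forall x, B x -> dotp p.1 x <= p.2.

Definition join f F : set 'rV[R]_n :=
  [set x | exists t : R, exists2 u, F u & 0 <= t <= 1 /\ x = (1 - t) *: f + t *: u].

Lemma conv_join f F : convex_set (F : set (convex_lmodType 'rV[R]_n)) ->
  F !=set0 -> conv (f |` F) = join f F.
Proof.
move=> cF [u0 Fu0]; apply/seteqP; split.
  apply: conv_min.
    apply/convex_setP => _ _ l l0 l1 [t [u Fu [/andP[t0 t1] ->]]]
      [s [v Fv [/andP[s0 s1] ->]]].
    pose T := (1 - l) * t + l * s.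
    have lt0 : 0 <= (1 - l) * t by rewrite mulr_ge0// subr_ge0.
    have ls0 : 0 <= l * s by rewrite mulr_ge0.
    have T0 : 0 <= T by rewrite addr_ge0.
    have T1 : T <= 1.
      have : (1 - l) * t <= (1 - l) * 1 by rewrite ler_wpM2l// subr_ge0.
      have : l * s <= l * 1 by rewrite ler_wpM2l.
      by rewrite /T; lra.
    (* [T] is the total weight on [F]; if it vanishes the point is [f]. *)
    have [T00|Tn0] := eqVneq T 0.
      have h1 : (1 - l) * t = 0 by apply/eqP; rewrite eq_le lt0 andbT -T00 lerDl.
      have h2 : l * s = 0 by apply/eqP; rewrite eq_le ls0 andbT -T00 lerDr.
      exists 0, u0 => //; split; first by rewrite lexx ler01.
      apply/rowP => i; rewrite !mxE.
      transitivity ((1 - (1 - l) * t - l * s) * f 0 i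
        + ((1 - l) * t) * u 0 i + (l * s) * v 0 i); first by ring.
      by rewrite h1 h2; ring.
    exists T, ((1 - l * s / T) *: u + (l * s / T) *: v).
      move/convex_setP : (cF); apply => //; first by rewrite divr_ge0.
      by rewrite ler_pdivrMr ?lt_neqAle 1?eq_sym ?Tn0// mul1r lerDr.
    split; first by rewrite T0 T1.
    apply/rowP => i; rewrite !mxE.
    have -> : T * ((1 - l * s / T) * u 0 i + l * s / T * v 0 i) =
       (T - l * s) * u 0 i + l * s * v 0 i by field.
    by rewrite /T; ring.
  move=> x [->|Fx].
    exists 0, u0 => //; split; first by rewrite lexx ler01.
    by rewrite subr0 scale1r scale0r addr0.
  exists 1, x => //; split; first by rewrite lexx ler01.
  by rewrite subrr scale1r scale0r add0r.
move=> _ [t [u Fu [/andP[t0 t1] ->]]].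
move/convex_setP : (@convex_conv (f |` F)); apply => //.
  by apply: sub_conv; left.
by apply: sub_conv; right.
Qed.

(** A face of [conv s] is determined by the points of [s] on it.  Rather than
    expanding a point into a combination of points of [s], one uses that the
    points strictly below the first hyperplane together with those on both
    hyperplanes form a convex set, which contains [s]. *)
Lemma exposed_trace (s : seq 'rV[R]_n) (p p' : 'rV[R]_n * R) :
  supports (conv [set` s]) p -> supports (conv [set` s]) p' ->
  (forall x, x \in s -> dotp p.1 x = p.2 -> dotp p'.1 x = p'.2) ->
  exposed (conv [set` s]) p `<=` exposed (conv [set` s]) p'.
Proof.
move=> hp hp' hs x [Bx px]; split => //.
pose C : set 'rV[R]_n :=
  [set x | dotp p.1 x < p.2 \/ (dotp p.1 x = p.2 /\ dotp p'.1 x = p'.2)].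
suff : C x by move=> [|[_ //]]; rewrite px ltxx.
move: x {px} Bx; apply: conv_min; last first.
  move=> x xs /=; have := hp x (sub_conv xs); rewrite le_eqVlt => /orP[/eqP e|].
    by right; split => //; exact: hs.
  by left.
apply/convex_setP => x y t t0 t1 hx hy; rewrite /C /= !dotp_conv.
have [->|tn0] := eqVneq t 0; first by rewrite subr0 !mul1r !mul0r !addr0.
have [->|tn1] := eqVneq t 1; first by rewrite subrr !mul1r !mul0r !add0r.
have tp : 0 < t by rewrite lt_neqAle eq_sym tn0.
have tp1 : 0 < 1 - t by rewrite subr_gt0 lt_neqAle tn1.
case: hx hy => [hx|[hx hx']] [hy|[hy hy']].
- left; have : t * dotp p.1 y < t * p.2 by rewrite ltr_pM2l.
  have : (1 - t) * dotp p.1 x < (1 - t) * p.2 by rewrite ltr_pM2l.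
  by lra.
- left; have : (1 - t) * dotp p.1 x < (1 - t) * p.2 by rewrite ltr_pM2l.
  by rewrite hy; lra.
- left; have : t * dotp p.1 y < t * p.2 by rewrite ltr_pM2l.
  by rewrite hx; lra.
- by right; rewrite hx hy hx' hy'; split; ring.
Qed.

(** There are at most as many faces as traces on the generating points, so one
    supporting hyperplane may be chosen for each trace that occurs. *)
Lemma finite_faces B : polytope B ->
  exists L : seq ('rV[R]_n * R),
    (forall p, p \in L -> [/\ supports B p, exposed B p <> set0 & exposed B p <> B]) /\
    (forall F, face B F -> F <> set0 -> F <> B ->
       exists2 p, p \in L & F = exposed B p).
Proof.
move=> [s ->]; set B0 := conv _.
pose ok (p : 'rV[R]_n * R) :=
  [/\ supports B0 p, exposed B0 p <> set0 & exposed B0 p <> B0].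
pose tr (p : 'rV[R]_n * R) : {ffun 'I_(size s) -> bool} :=
  [ffun i => dotp p.1 (tnth (in_tuple s) i) == p.2].
pose P m p := ok p /\ tr p = m.
pose pick m := xget (0, 0) [set p | P m p].
have pickP m p : P m p -> P m (pick m).
  by move=> h; exact: (@xgetPex _ (0, 0) (P m)) (ex_intro _ p h).
exists [seq pick m | m <- enum {ffun 'I_(size s) -> bool} & `[< exists p, P m p >]].
split=> [p /mapP[m]|F [a [b [hab ->]]] F0 FB].
  by rewrite mem_filter => /andP[/asboolP[q /pickP[? _] _]] ->.
have Pab : P (tr (a, b)) (a, b) by [].
have [[h1 _ _] h2] := pickP _ _ Pab.
exists (pick (tr (a, b))).
  apply: map_f; rewrite mem_filter mem_enum andbT.
  by apply/asboolP; exists (a, b).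
have same i : (dotp (pick (tr (a, b))).1 (tnth (in_tuple s) i) ==
    (pick (tr (a, b))).2) = (dotp a (tnth (in_tuple s) i) == b).
  by move/ffunP: h2 => /(_ i); rewrite !ffunE.
apply/seteqP; split.
  apply: (@exposed_trace s (a, b)) => // x /(tnthP (in_tuple s))[i ->] /= /eqP e.
  by apply/eqP; rewrite same.
apply: (@exposed_trace s _ (a, b)) => // x /(tnthP (in_tuple s))[i ->] /= /eqP e.
by apply/eqP; rewrite -same.
Qed.

Lemma polytope_bounded B : polytope B ->
  exists2 M : R, 0 <= M & forall x i, B x -> `|x 0 i| <= M.
Proof.
move=> [s ->]; exists (\sum_(x <- s) \sum_i `|x 0 i|).
  by apply: sumr_ge0 => x _; apply: sumr_ge0.
move=> x i; move: x; apply: conv_min.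
  apply/convex_setP => x y t t0 t1 /= hx hy; rewrite !mxE.
  apply: le_trans (ler_normD _ _) _; rewrite !normrM ger0_norm ?subr_ge0//.
  rewrite (ger0_norm t0).
  set M := \sum_(_ <- _) _ in hx hy *.
  have := ler_wpM2l t0 hy; have t0' : 0 <= 1 - t by rewrite subr_ge0.
  by have := ler_wpM2l t0' hx; lra.
move=> x /= xs; rewrite (big_rem x)//= (bigD1 i)//= -addrA lerDl addr_ge0//.
  exact: sumr_ge0.
by apply: sumr_ge0 => y _; exact: sumr_ge0.
Qed.

Lemma bounded_set_coord A (M : R) :
  (forall x i, A x -> `|x 0 i| <= M) -> bounded_set A.
Proof.
move=> hA; exists (`|M|); split; first exact: normr_real.
move=> N MN x Ax; rewrite /Num.norm /= mx_normrE; apply/bigmax_leP; split.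
  by rewrite (le_trans _ (ltW MN)).
move=> [j i] _ /=; rewrite [j]ord1; apply: le_trans (hA _ _ Ax) _.
by rewrite (le_trans (ler_norm _))// ltW.
Qed.

Lemma continuous_dotp a : continuous (fun x => dotp a x).
Proof.
apply: (@continuous_big R 'I_n +%R 0 xpredT (@add_continuous R)) => i _ x.
apply: (@continuousM R 'rV[R]_n (fun=> a 0 i) (fun x => x 0 i) x).
  exact: cst_continuous.
exact: coord_continuous.
Qed.

Lemma closed_exposed B (p : 'rV[R]_n * R) : closed B -> closed (exposed B p).
Proof.
move=> cB; apply: closedI => //.
have /continuous_closedP hc := @continuous_dotp p.1.
have c2 : closed [set x : R | x = p.2] by exact: closed_eq.
exact: hc _ c2.
Qed.

Lemma compact_join f F : compact F -> compact (join f F).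
Proof.
move=> cF; pose g (tu : R * 'rV[R]_n) := (1 - tu.1) *: f + tu.1 *: tu.2.
have -> : join f F = g @` (`[0, 1]%classic `*` F).
  apply/seteqP; split.
    by move=> _ [t [u Fu [t01 ->]]]; exists (t, u) => //; split => //=; rewrite in_itv.
  by move=> _ [[t u] [t01 Fu] <-]; exists t, u.
apply: continuous_compact.
  apply: continuous_subspaceT => tu; rewrite /g.
  apply: cvgD.
    apply: cvgZr_tmp; apply: cvgB; [exact: cvg_cst|exact: cvg_fst].
  by apply: cvgZ; [exact: cvg_fst|exact: cvg_snd].
by apply: compact_setX => //; exact: segment_compact.
Qed.

End convex_geometry.

(** * Interior points of polytopes *)

Section convex_interior.
Context {R : realType} {n : nat}.
Implicit Types (A B C F : set 'rV[R]_n) (a c f q r x y z v w : 'rV[R]_n)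
  (p : 'rV[R]_n * R).

Lemma interior_normP B x :
  interior B x <-> exists2 e : R, 0 < e & forall y, `|x - y| < e -> B y.
Proof.
split=> [/nbhs_normP[e e0 he]|[e e0 he]]; first by exists e.
by apply/(@nbhs_normP R 'rV[R]_n); exists e.
Qed.

(** The homothety of ratio [1 - l] and centre [y] maps a ball around [r] inside
    [B] to a ball inside [B]. *)
Lemma interior_conv B r y (l : R) :
  convex_set (B : set (convex_lmodType 'rV[R]_n)) ->
  interior B r -> B y -> 0 <= l -> l < 1 -> interior B ((1 - l) *: r + l *: y).
Proof.
move=> /convex_setP cB /interior_normP[e e0 he] By l0 l1.
have l1' : 0 < 1 - l by rewrite subr_gt0.
apply/interior_normP; exists ((1 - l) * e); first exact: mulr_gt0.
move=> u hu.
pose u' := (1 - l)^-1 *: (u - l *: y).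
have -> : u = (1 - l) *: u' + l *: y.
  by rewrite scalerA divff ?gt_eqF// scale1r subrK.
apply: cB => //; [exact: ltW|apply: he].
have -> : r - u' = (1 - l)^-1 *: ((1 - l) *: r + l *: y - u).
  by apply/rowP => i; rewrite !mxE; field; rewrite gt_eqF.
by rewrite normrZ gtr0_norm ?invr_gt0// mulrC ltr_pdivrMr// mulrC.
Qed.

(** A relative interior point, characterized by the fact that the segments from
    the generating points to it can be prolonged inside the hull.  A new
    generator is accounted for by passing to its midpoint with the old [c]. *)
Lemma core_point (s : seq 'rV[R]_n) : s != [::] ->
  exists2 c, conv [set` s] c &
  forall x, x \in s -> exists2 e : R, 0 < e & conv [set` s] (c - e *: (x - c)).
Proof.
suff H (C : set 'rV[R]_n) (s' : seq 'rV[R]_n) :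
    convex_set (C : set (convex_lmodType 'rV[R]_n)) ->
    (forall x, x \in s' -> C x) -> s' != [::] ->
    exists2 c, C c &
    forall x, x \in s' -> exists2 e : R, 0 < e & C (c - e *: (x - c)).
  by move=> s0; apply: H => //; [exact: convex_conv|move=> x xs; exact: sub_conv].
move=> /convex_setP cC; elim: s' => [|x s' IH]//= hs _.
have Cx : C x by apply: hs; rewrite mem_head.
have [->|s'0] := eqVneq s' [::].
  exists x => // y; rewrite inE => /eqP ->; exists 1 => //.
  by rewrite subrr scaler0 subr0.
have [c Cc hc] := IH (fun y ys => hs y (mem_behead (s := _ :: _) ys)) s'0.
have h2 : (0 : R) <= 2^-1 by rewrite invr_ge0.
have h21 : (2^-1 : R) <= 1 by lra.
exists ((1 - 2^-1) *: x + 2^-1 *: c); first exact: cC.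
move=> y; rewrite inE => /orP[/eqP ->|ys].
  exists 1 => //; rewrite (_ : _ - _ = c)//.
  by apply/rowP => i; rewrite !mxE; field.
have [e e0 he] := hc y ys.
have e2 : 0 < 2 + e by lra.
(* The factor for which the prolonged point is the combination of [x] and
   [c - e *: (y - c)] below. *)
exists (e / (2 + e)); first by rewrite divr_gt0.
have d0 : 0 <= e / (2 + e) by rewrite divr_ge0// ltW.
have d1 : e / (2 + e) <= 1 by rewrite ler_pdivrMr// mul1r lerDr.
pose t := (1 - e / (2 + e)) / 2.
rewrite (_ : _ - _ = (1 - t) *: x + t *: (c - e *: (y - c))); last first.
  by apply/rowP => i; rewrite !mxE /t; field; rewrite gt_eqF.
by apply: cC => //; rewrite /t; lra.
Qed.

(** The directions in which one can move both ways from a relative interior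
    point form a linear subspace [V].  Since [c + V] contains the polytope, it
    contains its affine hull, so [V] is everything; moving along the coordinate
    directions then gives a ball. *)
Lemma interior_polytope B : polytope B -> full_dimensional B ->
  exists c, interior B c.
Proof.
move=> [s ->] hfull; set B0 := conv _.
have s0 : s != [::].
  apply/eqP => s0; have : affine_hull B0 0 by rewrite hfull.
  apply: (_ : affine_hull B0 `<=` set0); apply: smallest_sub.
    by move=> x y t [].
  rewrite /B0 s0; apply: conv_min => [|x]; last by rewrite /= in_nil.
  by apply/convex_setP => x y t _ _ [].
have [c Bc hc] := core_point s0; rewrite -/B0 in Bc hc.
have /convex_setP cB : convex_set (B0 : set (convex_lmodType 'rV[R]_n)).
  exact: convex_conv.
pose V v := exists2 e : R, 0 < e & B0 (c + e *: v) /\ B0 (c - e *: v).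
have shrink (e e' : R) v : 0 < e -> `|e'| <= e ->
    B0 (c + e *: v) -> B0 (c - e *: v) -> B0 (c + e' *: v).
  move=> e0; rewrite ler_norml => /andP[h1 h2] Bp Bm.
  pose t := (e + e') / (2 * e).
  rewrite (_ : _ + _ = (1 - t) *: (c - e *: v) + t *: (c + e *: v)); last first.
    by apply/rowP => i; rewrite !mxE /t; field; rewrite gt_eqF.
  apply: cB => //; first by rewrite divr_ge0//; lra.
  by rewrite ler_pdivrMr; lra.
have V0 : V 0 by exists 1 => //; rewrite scaler0 subr0 addr0.
have VZ k v : V v -> V (k *: v).
  move=> [e e0 [Bp Bm]]; have [->|k0] := eqVneq k 0; first by rewrite scale0r.
  have k0' : 0 < `|k| by rewrite normr_gt0.
  exists (e / `|k|); first by rewrite divr_gt0.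
  rewrite -scaleNr !scalerA.
  have h : `|e / `|k| * k| <= e.
    by rewrite normrM normf_div normr_id (gtr0_norm e0) divfK// gt_eqF.
  by split; apply: shrink Bp Bm => //; rewrite mulNr normrN.
have VD v w : V v -> V w -> V (v + w).
  move=> [e e0 [Bp Bm]] [e' e'0 [Bp' Bm']].
  pose m := Num.min e e'.
  have m0 : 0 < m by rewrite lt_min e0.
  have h1 : `|m| <= e by rewrite gtr0_norm// ge_min lexx.
  have h2 : `|m| <= e' by rewrite gtr0_norm// ge_min lexx orbT.
  have h1' : `|- m| <= e by rewrite normrN.
  have h2' : `|- m| <= e' by rewrite normrN.
  exists (m / 2); first by rewrite divr_gt0.
  split.
    rewrite (_ : _ + _ = (1 - 2^-1) *: (c + m *: v) + 2^-1 *: (c + m *: w)).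
      by apply: cB; [lra|lra|exact: shrink h1 Bp Bm|exact: shrink h2 Bp' Bm'].
    by apply/rowP => i; rewrite !mxE; field.
  rewrite (_ : _ - _ = (1 - 2^-1) *: (c + (- m) *: v) + 2^-1 *: (c + (- m) *: w)).
    by apply: cB; [lra|lra|exact: shrink h1' Bp Bm|exact: shrink h2' Bp' Bm'].
  by apply/rowP => i; rewrite !mxE; field.
have VT v : V v.
  have Vaff : affine_set [set x | V (x - c)].
    move=> x y t Vx Vy /=.
    rewrite (_ : _ - c = (1 - t) *: (x - c) + t *: (y - c)).
      by apply: VD; apply: VZ.
    by apply/rowP => i; rewrite !mxE; ring.
  have : affine_hull B0 (c + v) by rewrite hfull.
  move/(smallest_sub Vaff); rewrite /= addrC addKr; apply.
  apply: conv_min => [|x xs /=].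
    apply/convex_setP => x y t _ _; exact: Vaff.
  have [e e0 he] := hc x xs.
  have Bx : B0 (c + 1 *: (x - c)).
    by rewrite scale1r addrC subrK; exact: sub_conv.
  pose m := Num.min e 1.
  have m0 : 0 < m by rewrite lt_min e0 ltr01.
  exists m => //; split.
    rewrite (_ : _ + _ = (1 - m) *: c + m *: (c + 1 *: (x - c))).
      by apply: cB => //; [exact: ltW|rewrite ge_min lexx orbT].
    by apply/rowP => i; rewrite !mxE; ring.
  rewrite (_ : _ - _ = (1 - m / e) *: c + (m / e) *: (c - e *: (x - c))).
    apply: cB => //; first by rewrite divr_ge0// ltW.
    by rewrite ler_pdivrMr// mul1r ge_min lexx.
  by apply/rowP => i; rewrite !mxE; field; rewrite gt_eqF.
have box (t : seq 'I_n) : uniq t -> exists2 e : R, 0 < e &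
    forall v, (forall i, i \notin t -> v 0 i = 0) ->
      (forall i, `|v 0 i| <= e) -> B0 (c + v).
  elim: t => [_|j t IH /= /andP[jt /IH[e e0 he]]].
    exists 1 => // v hv _; rewrite (_ : v = 0) ?addr0//.
    by apply/rowP => i; rewrite hv// mxE.
  have [e' e'0 [Bp Bm]] := VT (delta_mx 0 j).
  pose m := Num.min e e'.
  have m0 : 0 < m by rewrite lt_min e0.
  have me : m <= e by rewrite ge_min lexx.
  have me' : m <= e' by rewrite ge_min lexx orbT.
  exists (m / 2); first by rewrite divr_gt0.
  move=> v hv hvm.
  pose v' : 'rV[R]_n := \row_i (if i == j then 0 else 2 * v 0 i).
  rewrite (_ : c + v = (1 - 2^-1) *: (c + (2 * v 0 j) *: delta_mx 0 j) +
    2^-1 *: (c + v')); last first.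
    apply/rowP => i; rewrite !mxE /=; have [->|ij] := eqVneq i j => /=.
      by rewrite ?eqxx /=; field.
    by field.
  have hv2 i : `|2 * v 0 i| <= m.
    by rewrite normrM ger0_norm//; have := hvm i; lra.
  apply: cB; [lra|lra| |].
    by apply: shrink Bp Bm => //; apply: le_trans (hv2 j) _.
  apply: he => i; rewrite mxE; have [//|ij] := eqVneq i j.
  - by move=> it; rewrite hv ?mulr0// inE negb_or ij.
  - by move=> _; rewrite normr0 ltW.
  - by apply: le_trans (hv2 i) _.
have [e e0 he] := box _ (enum_uniq 'I_n).
exists c; change (nbhs c B0); apply/nbhs_ballP; exists e => // y [_ hy].
rewrite -[y](subrK c) addrC; apply: he => i; first by rewrite mem_enum.
have := hy 0 i; rewrite /ball /= !mxE distrC => /ltW.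
by [].
Qed.

End convex_interior.

(** * Null boundary and volume modulo the lattice *)

Section boundary_and_lattice.
Context {R : realType} {n : nat}.
Implicit Types (A B C F Y : set 'rV[R]_n) (a c f q r u v x y z w : 'rV[R]_n)
  (p : 'rV[R]_n * R).

Lemma bernoulli (e : R) m : 0 <= e -> e <= 1 -> 1 - m%:R * e <= (1 - e) ^+ m.
Proof.
move=> e0 e1; elim: m => [|m IH]; first by rewrite mul0r subr0 expr0.
have e1' : 0 <= 1 - e by rewrite subr_ge0.
rewrite exprS; apply: le_trans (ler_wpM2l e1' IH).
rewrite -natr1; have : 0 <= m%:R * e * e by rewrite !mulr_ge0.
by lra.
Qed.

Lemma volDI A B : mset A -> mset B -> vol A = (vol (A `\` B) + vol (A `&` B))%E.
Proof. exact: measureDI. Qed.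

Lemma vol_fin_bigcup (I : choiceType) (D : set I) (F : I -> set 'rV[R]_n) :
  finite_set D -> (forall i, D i -> mset (F i)) ->
  (forall i j x, D i -> D j -> F i x -> F j x -> i = j) ->
  vol (\bigcup_(i in D) F i) = (\sum_(i \in D) vol (F i))%E.
Proof.
move=> fD mF tF; rewrite volE preimage_bigcup measure_fin_bigcup//.
apply/trivIsetP => i j Di Dj ij; apply/seteqP; split => // t [/= Fi Fj].
by move: ij; rewrite (tF i j _ Di Dj Fi Fj) eqxx.
Qed.

Lemma mset_interior B : mset (interior B).
Proof. by apply: mset_open; exact: open_interior. Qed.

(** Shrinking [B] by a factor [1 - e] towards an interior point carries it into
    its interior, so the volume of the interior is at least [(1 - e) ^+ n] times
    that of [B], for every small [e], hence not smaller than that of [B]. *)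
Lemma vol_boundary B c (M : R) : closed B ->
  convex_set (B : set (convex_lmodType 'rV[R]_n)) -> interior B c ->
  (forall x i, B x -> `|x 0 i| <= M) -> vol (B `\` interior B) = 0%E.
Proof.
move=> clB cB Bc hM.
have mB : mset B by exact: mset_closed.
have mI := mset_interior B.
have IB : interior B `<=` B by exact: interior_subset.
have volB : vol B \is a fin_num.
  by rewrite ge0_fin_numE ?measure_ge0//; exact: vol_bounded_fin mB hM.
have volI : vol (interior B) \is a fin_num.
  rewrite ge0_fin_numE ?measure_ge0//; apply: vol_bounded_fin mI _ => x i /IB.
  exact: hM.
have shrink (e : R) : 0 < e -> e < 1 ->
    (1 - e) ^+ n * fine (vol B) <= fine (vol (interior B)).
  move=> e0 e1; have l0 : 0 < 1 - e by rewrite subr_gt0.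
  have [g1 g2] := scales_vol_comp (scales_vol_translation (e *: c))
    (scales_vol_homothety (lt0r_neq0 l0)).
  have /le_vol : B `<=` ((fun x => x + e *: c) \o (fun x => (1 - e) *: x)) @^-1` interior B.
    move=> x Bx /=; rewrite (_ : _ + _ = (1 - (1 - e)) *: c + (1 - e) *: x).
      by apply: interior_conv => //; [exact: ltW|rewrite ltrBlDr ltrDl].
    by apply/rowP => i; rewrite !mxE; ring.
  move=> /(_ mB (g1 _ mI)); rewrite g2// mul1r.
  rewrite -[X in (X <= _)%E]fineK// -[X in (_ <= _ * X)%E]fineK// -EFinM lee_fin.
  move=> h; rewrite -ler_pdivlMl ?exprn_gt0//.
  by rewrite -exprVn -[X in X ^+ n]gtr0_norm ?invr_gt0.
have BI : fine (vol B) <= fine (vol (interior B)).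
  have V0 : 0 <= fine (vol B) by rewrite fine_ge0 ?measure_ge0.
  apply/ler_addgt0Pr => d d0.
  (* By Bernoulli the loss is at most [n * e * vol B]; [k] bounds its slope. *)
  pose k := n%:R * fine (vol B) + 1.
  have k0 : 0 < k by rewrite ltr_wpDl// mulr_ge0.
  pose e := Num.min (2^-1) (d / k).
  have e0 : 0 < e by rewrite lt_min invr_gt0 ltr0n divr_gt0.
  have e1 : e < 1 by rewrite gt_min; apply/orP; left; lra.
  have ed : e * k <= d by rewrite -ler_pdivlMr// ge_min lexx orbT.
  have := shrink e e0 e1; have := bernoulli n (ltW e0) (ltW e1).
  move=> /(ler_wpM2r V0); rewrite /k in ed; lra.
have E : vol B = (vol (B `\` interior B) + vol (interior B))%E.
  rewrite [LHS](volDI mB mI); congr (_ + vol _)%E.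
  by apply/setIidPr.
have Dfin : vol (B `\` interior B) \is a fin_num.
  rewrite ge0_fin_numE ?measure_ge0//; apply: (vol_bounded_fin (msetD mB mI)).
  by move=> x i [Bx _]; exact: hM.
apply/eqP; rewrite eq_le measure_ge0 andbT -(fineK Dfin) lee_fin.
by move: BI; rewrite E fineD//; lra.
Qed.

Lemma latticeD x y : lattice x -> lattice y -> lattice (x + y).
Proof. by move=> hx hy i; rewrite mxE rpredD. Qed.

Lemma latticeB x y : lattice x -> lattice y -> lattice (x - y).
Proof. by move=> hx hy i; rewrite !mxE rpredB. Qed.

Lemma latticeN x : lattice x -> lattice (- x).
Proof. by move=> hx i; rewrite mxE rpredN. Qed.

Lemma lattice_finite (M : R) : exists s : seq 'rV[R]_n,
  (forall z, z \in s -> lattice z) /\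
  (forall z, lattice z -> (forall i, `|z 0 i| <= M) -> z \in s).
Proof.
pose N := Num.bound `|M|.
pose g (h : {ffun 'I_n -> 'I_(N + N).+1}) : 'rV[R]_n :=
  \row_i ((h i : nat)%:R - N%:R).
exists [seq g h | h : {ffun 'I_n -> 'I_(N + N).+1}]; split.
  move=> _ /mapP[h _ ->] i; by rewrite mxE rpredB ?natr_int.
move=> z Lz hz; apply/mapP.
have hN i : exists k : 'I_(N + N).+1, z 0 i = (k : nat)%:R - N%:R.
  have /Num.Theory.intrP[m zm] := Lz i.
  have : `|z 0 i| <= N%:R.
    apply: le_trans (hz i) _; apply: le_trans (ler_norm _) _.
    exact/ltW/archi_boundP/normr_ge0.
  rewrite zm ler_norml -[N%:R]/(N%:Z%:~R) -rmorphN !ler_int => /andP[h1 h2].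
  (* Shifting by [N] makes the coordinate a natural number. *)
  have mN : `|(m + N%:Z)%R|%N%:Z = m + N%:Z by rewrite gez0_abs//; lia.
  have lt : (`|(m + N%:Z)%R|%N < (N + N).+1)%N.
    by rewrite ltnS; lia.
  exists (Ordinal lt) => /=; rewrite -[_%:R]/(_%:Z%:~R) mN rmorphD /=.
  by rewrite addrK.
exists [ffun i => sval (cid (hN i))]; first by rewrite mem_enum.
by apply/rowP => i; rewrite mxE ffunE; case: (cid _).
Qed.

Definition cube : set 'rV[R]_n := [set x | forall i, 0 <= x 0 i < 1].

Lemma mset_cube : mset cube.
Proof.
rewrite (_ : cube = \bigcap_(i in [set: 'I_n])
    (fun x : 'rV[R]_n => x 0 i) @^-1` `[0, 1[%classic).
  rewrite /mset preimage_bigcap; apply: fin_bigcap_measurable => //.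
  by move=> i _; apply: (mset_preimage_fun (mfun_coord i)); exact: measurable_itv.
by apply/seteqP; split => [x h i _|x h i]; have := h i; rewrite /= in_itv; exact.
Qed.

Lemma cube_lattice_eq x y : cube x -> cube y -> lattice (x - y) -> x = y.
Proof.
move=> cx cy Lxy; apply/rowP => i.
have /Num.Theory.intrP[m] := Lxy i; rewrite !mxE => e.
have /andP[x0 x1] := cx i; have /andP[y0 y1] := cy i.
have m1 : m < 1 by rewrite -(ltr_int R) -e; lra.
have m0 : - 1 < m by rewrite -(ltr_int R) -e; lra.
have m00 : m = 0 by lia.
by move: e; rewrite m00; lra.
Qed.

Lemma frac_partP x y : frac_part x = y <-> cube y /\ lattice (y - x).
Proof.
have L : lattice (frac_part x - x).
  move=> i; rewrite !mxE addrAC subrr sub0r rpredN; exact: intr_int.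
have C : cube (frac_part x).
  move=> i; rewrite mxE subr_ge0 ge_floor /= ltrBlDr.
  by have := lt_succ_floor (x 0 i); rewrite intrD addrC.
split=> [<- //|[cy Ly]]; apply: cube_lattice_eq => //.
rewrite (_ : _ - y = (frac_part x - x) - (y - x)); first exact: latticeB.
by rewrite opprB addrA subrK.
Qed.

Lemma mod_latticeP Y y :
  mod_lattice Y y <-> cube y /\ exists2 x, Y x & lattice (y - x).
Proof.
split=> [[x Yx /frac_partP[cy Ly]]|[cy [x Yx Ly]]]; first by split => //; exists x.
by exists x => //; apply/frac_partP.
Qed.

(** Only finitely many unit cubes meet a bounded set. *)
Lemma mod_lattice_bigcup Y (M : R) : (forall x i, Y x -> `|x 0 i| <= M) ->
  exists W : seq 'rV[R]_n, (forall w, w \in W -> lattice w) /\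
    mod_lattice Y = \bigcup_(w in [set` W]) [set y | cube y /\ Y (y - w)] /\
    Y = \bigcup_(w in [set` W]) [set x | cube (x + w) /\ Y x].
Proof.
move=> hM; have [W [WL hW]] := lattice_finite (M + 1).
have inW x w : Y x -> cube (x + w) -> lattice w -> w \in W.
  move=> Yx cxw Lw; apply: hW => // i; have /andP[] := cxw i; rewrite mxE.
  by have := hM x i Yx; rewrite !ler_norml => /andP[]; lra.
exists W; split => //; split; apply/seteqP; split.
- move=> y /mod_latticeP[cy [x Yx Ly]]; exists (y - x); last first.
    by split=> //; rewrite opprB addrC subrK.
  by apply: (inW x) => //; rewrite addrC subrK.
- move=> y [w /= /WL Lw [cy Yy]]; apply/mod_latticeP; split => //.
  by exists (y - w) => //; rewrite opprB addrC subrK.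
- move=> x Yx; have /frac_partP[c L] := erefl (frac_part x).
  have c' : cube (x + (frac_part x - x)) by rewrite addrC subrK.
  by exists (frac_part x - x) => //; exact: (inW x).
- by move=> x [w _ []].
Qed.

Lemma mset_cube_translate Y w : mset Y -> mset [set y | cube y /\ Y (y - w)].
Proof.
move=> mY; have [g1 _] := scales_vol_translation (- w).
exact: msetI mset_cube (g1 _ mY).
Qed.

Lemma mset_mod_lattice Y (M : R) : mset Y -> (forall x i, Y x -> `|x 0 i| <= M) ->
  mset (mod_lattice Y).
Proof.
move=> mY /mod_lattice_bigcup[W [_ [-> _]]].
by apply: mset_bigcup_seq => w _; exact: mset_cube_translate.
Qed.

Lemma vol_cube_translate Y w : mset Y ->
  vol [set y | cube y /\ Y (y - w)] = vol [set x | cube (x + w) /\ Y x].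
Proof.
move=> mY; have [h1 _] := scales_vol_translation w.
have mcY : mset [set x | cube (x + w) /\ Y x].
  exact: msetI (h1 _ mset_cube) mY.
have [_ g2] := scales_vol_translation (- w).
rewrite -[RHS]mul1e -g2//; congr vol.
by apply/seteqP; split => y /=; rewrite subrK.
Qed.

(** The unit cubes cut [Y] into pieces which are translated into a single cube;
    injectivity makes the translates disjoint. *)
Lemma vol_mod_lattice_inj Y (M : R) : mset Y ->
  (forall x i, Y x -> `|x 0 i| <= M) ->
  (forall x y, Y x -> Y y -> lattice (x - y) -> x = y) ->
  vol (mod_lattice Y) = vol Y.
Proof.
move=> mY hM hY; have [W [WL [modE YE]]] := mod_lattice_bigcup hM.
rewrite modE [in RHS]YE !(vol_fin_bigcup (finite_seq W))//.
- by apply: eq_fsbigr => w _; exact: vol_cube_translate.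
- move=> w _; have [h1 _] := scales_vol_translation w.
  exact: msetI (h1 _ mset_cube) mY.
- move=> w w' x /WL Lw /WL Lw' [cx _] [cx' _]; apply: (addrI x).
  apply: cube_lattice_eq => //; rewrite opprD addrACA subrr add0r.
  exact: latticeB.
- by move=> w _; exact: mset_cube_translate.
- move=> w w' y /WL Lw /WL Lw' [_ Yw] [_ Yw'].
  have : y - w = y - w'.
    apply: hY => //; rewrite (_ : _ - _ = w' - w); first exact: latticeB.
    by apply/rowP => i; rewrite !mxE; ring.
  by move/addrI/oppr_inj.
Qed.

Lemma vol_mod_lattice_null Y (M : R) : mset Y ->
  (forall x i, Y x -> `|x 0 i| <= M) -> vol Y = 0%E -> vol (mod_lattice Y) = 0%E.
Proof.
move=> mY hM Y0; have [W [_ [modE _]]] := mod_lattice_bigcup hM.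
pose Q w := [set y | cube y /\ Y (y - w)].
have S0 : (\sum_(w \in [set` W]) vol (Q w))%E = 0%E.
  rewrite fsbig1// => w _; rewrite /Q vol_cube_translate//.
  have [h1 _] := scales_vol_translation w.
  by apply: (vol_null_subset (msetI (h1 _ mset_cube) mY) mY) => // x [].
apply/eqP; rewrite eq_le measure_ge0 andbT -S0 modE volE preimage_bigcup.
apply: content_sub_fsum => //; first exact: finite_seq.
  by move=> w _; exact: mset_cube_translate.
by apply: fin_bigcup_measurable => // w _; exact: mset_cube_translate.
Qed.

End boundary_and_lattice.

(** * Spindles and their collisions *)

Section spindles.
Context {R : realType} {n : nat}.
Implicit Types (B F Y : set 'rV[R]_n) (a c f q r u v x y z w : 'rV[R]_n)
  (p : 'rV[R]_n * R).

(** The point [x] of the spindle together with its height [t]: the symmetry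
    [x |-> z + f - x] of the spindle exchanges the heights [t] and [1 - t].
    Keeping [t] in the data
    covers the case when [f] is on the face and the height is not a function
    of [x]. *)
Definition spin B f p z (t : R) x := 0 <= t <= 1 /\
  exists u v, [/\ exposed B p u, exposed B p v, x = (1 - t) *: f + t *: u &
                  z + f - x = t *: f + (1 - t) *: v].

Lemma convex_exposed B p : convex_set (B : set (convex_lmodType 'rV[R]_n)) ->
  convex_set (exposed B p : set (convex_lmodType 'rV[R]_n)).
Proof. by move=> cB; apply: convex_setI => //; exact: convex_hyperplane. Qed.

Lemma spin_spindle B f p z t x :
  convex_set (B : set (convex_lmodType 'rV[R]_n)) ->
  spin B f p z t x -> spindle f (exposed B p) z x.
Proof.
move=> cB [/andP[t0 t1] [u [v [Fu Fv xE zE]]]].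
have -> : spindle f (exposed B p) z = join f (exposed B p) `&`
    [set z + f - y | y in join f (exposed B p)].
  by rewrite /spindle conv_join//; [exact: convex_exposed|exists u].
split; first by exists t, u => //; rewrite t0 t1.
exists (z + f - x); last by rewrite opprB addrCA subrr addr0.
exists (1 - t), v => //; split; first by rewrite subr_ge0 t1 gerBl.
by rewrite subKr.
Qed.

Lemma spindle_spin B f p z x :
  convex_set (B : set (convex_lmodType 'rV[R]_n)) ->
  dotp p.1 f < p.2 -> exposed B p z ->
  spindle f (exposed B p) z x -> exists t, spin B f p z t x.
Proof.
move=> cB fp Fz; rewrite /spindle conv_join//; [|exact: convex_exposed|by exists z].
move=> [[t [u Fu [t01 xE]]] [_ [s [v Fv [s01 ->]] xE']]].
have st : s = 1 - t.
  have [_ pz] := Fz; have [_ pu] := Fu; have [_ pv] := Fv.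
  have := congr1 (dotp p.1) xE'; rewrite xE dotpBr dotpDr !dotp_conv pz pu pv => e.
  have : (s - (1 - t)) * (p.2 - dotp p.1 f) = 0.
    by move: e; lra.
  by move/eqP; rewrite mulf_eq0 [X in _ || X]subr_eq0 [X in _ || X]gt_eqF// orbF
    subr_eq0 => /eqP.
exists t; split => //; exists u, v; split => //.
by rewrite -xE' opprB addrCA subrr addr0 st subKr.
Qed.

(** The base points [u] and [v] are kept: only the apex moves. *)
Lemma spin_move B f f' p z t x :
  spin B f p z t x -> spin B f' p z t (x + (1 - t) *: (f' - f)).
Proof.
move=> [t01 [u [v [Fu Fv xE zE]]]]; split => //; exists u, v; split => //.
  by rewrite xE; apply/rowP => i; rewrite !mxE; ring.
have -> : z + f' - (x + (1 - t) *: (f' - f)) = (z + f - x) + t *: (f' - f).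
  by apply/rowP => i; rewrite !mxE; ring.
by rewrite zE; apply/rowP => i; rewrite !mxE; ring.
Qed.

Lemma spin_height B f p z t x : spin B f p z t x ->
  p.2 - dotp p.1 x = (1 - t) * (p.2 - dotp p.1 f).
Proof.
by move=> [_ [u [v [[_ pu] _ -> _]]]]; rewrite dotp_conv pu; ring.
Qed.

Lemma spin_in B f p z t x : convex_set (B : set (convex_lmodType 'rV[R]_n)) ->
  B f -> spin B f p z t x -> B x /\ B (z + f - x).
Proof.
move=> /convex_setP cB Bf [/andP[t0 t1] [u [v [[Bu _] [Bv _] xE zE]]]].
split; first by rewrite xE; exact: cB.
by rewrite zE -[X in X *: f](subKr 1) ; apply: cB => //; rewrite ?subr_ge0 ?gerBl.
Qed.

(** If [x'] were lower than [x], the lattice point [z + (x' - x)] would be a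
    convex combination of the interior point [z + f - x] and of points of [B],
    with weight [1 - t' / t > 0] on the former. *)
Lemma spin_collision B f p p' z z' t t' x x' :
  convex_set (B : set (convex_lmodType 'rV[R]_n)) ->
  interior B `&` lattice = set0 -> B f ->
  spin B f p z t x -> spin B f p' z' t' x' ->
  lattice z -> lattice (x' - x) -> interior B (z + f - x) -> t <= t'.
Proof.
move=> cB BL Bf [/andP[t0 t1] [u [v [_ [Bv _] _ zE]]]].
move=> [/andP[t'0 t'1] [u' [v' [[Bu' _] _ xE' _]]]] Lz Lx Br.
rewrite leNgt; apply/negP => tt'.
have tp : 0 < t by exact: le_lt_trans tt'.
suff : (interior B `&` lattice) (z + (x' - x)) by rewrite BL.
split; last exact: latticeD.
have By : B ((1 - t) *: v + t *: u') by move/convex_setP : cB; exact.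
rewrite (_ : z + _ = (1 - t' / t) *: (z + f - x) + (t' / t) *: ((1 - t) *: v + t *: u')).
  apply: interior_conv => //; first by rewrite divr_ge0.
  by rewrite ltr_pdivrMr// mul1r.
transitivity ((z + f - x) + (x' - f)).
  by apply/rowP => i; rewrite !mxE; ring.
rewrite zE xE'; apply/rowP => i; rewrite !mxE; field.
by rewrite gt_eqF.
Qed.

(** With an interior apex, [z + f - x] is interior as soon as [0 < t], having
    weight [t] on the apex. *)
Lemma spin_collision_interior B f p p' z z' t t' x x' :
  convex_set (B : set (convex_lmodType 'rV[R]_n)) ->
  interior B `&` lattice = set0 -> interior B f ->
  spin B f p z t x -> spin B f p' z' t' x' ->
  lattice z -> lattice (x' - x) -> t <= t'.
Proof.
move=> cB BL If hx hx' Lz Lx; have Bf := interior_subset If.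
have [t'01 _] := hx'; have /andP[t'0 _] := t'01.
have [|tp] := leP t 0; first by move=> t0; exact: le_trans t'0.
apply: (spin_collision cB BL Bf hx hx' Lz Lx).
have [/andP[t0 t1] [u [v [_ [Bv _] _ ->]]]] := hx.
rewrite -[X in X *: f](subKr 1); apply: interior_conv => //.
  by rewrite subr_ge0.
by rewrite gtrBl.
Qed.

(** Otherwise, prolonging beyond [f] the segment from a point of [B] off the
    hyperplane would leave [B] through that hyperplane. *)
Lemma interior_supports B p f : interior B f -> supports B p ->
  exposed B p <> B -> dotp p.1 f < p.2.
Proof.
move=> If hp nB; have Bf := interior_subset If.
rewrite lt_neqAle hp// andbT; apply/eqP => fp; apply: nB.
apply/seteqP; split => [x []//|y By]; split => //=.
apply/eqP; rewrite eq_le hp//=.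
have /interior_normP[e e0 he] := If.
pose d := e / (`|y - f| + 1).
have d0 : 0 < d by rewrite divr_gt0// ltr_wpDl.
have /he/hp : `|f - (f - d *: (y - f))| < e.
  rewrite subKr normrZ gtr0_norm// /d mulrAC ltr_pdivrMr ?ltr_wpDl//.
  by rewrite ltr_pM2l// ltrDl.
rewrite dotpBr dotpZr dotpBr fp => h.
have : 0 <= d * (dotp p.1 y - p.2) by lra.
by rewrite pmulr_rge0// subr_ge0.
Qed.

Lemma mset_spindle B f p z (M : R) :
  convex_set (B : set (convex_lmodType 'rV[R]_n)) -> closed B ->
  (forall x i, B x -> `|x 0 i| <= M) -> exposed B p z ->
  mset (spindle f (exposed B p) z).
Proof.
move=> cB clB hM Fz.
have cC : compact (join f (exposed B p)).
  apply: compact_join; apply: bounded_closed_compact.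
    by apply: (@bounded_set_coord _ _ _ M) => x i [Bx _]; exact: hM.
  exact: closed_exposed.
have mC : mset (join f (exposed B p)).
  by apply: mset_closed; apply: compact_closed cC; exact: norm_hausdorff.
rewrite /spindle conv_join; [|exact: convex_exposed|by exists z].
apply: msetI => //.
have N1 : -1 != 0 :> R by rewrite oppr_eq0 oner_neq0.
have [g1 _] := scales_vol_comp (scales_vol_translation (z + f))
  (scales_vol_homothety N1).
rewrite (_ : [set _ | _ in _] =
  ((fun x => x + (z + f)) \o (fun x => -1 *: x)) @^-1` join f (exposed B p)).
  exact: g1.
apply/seteqP; split => [_ [y Cy <-]|x /= Cx]; rewrite /= ?scaleN1r.
  by rewrite opprB subrK.
exists (z + f - x); last by rewrite opprB addrCA subrr addr0.
by rewrite addrC -scaleN1r.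
Qed.

Lemma affine_function_sum m (h : 'I_m -> 'rV[R]_n -> R) :
  (forall j, affine_function (h j)) ->
  affine_function (fun x => \sum_(j < m) h j x).
Proof.
elim: m h => [|m IH] h hh.
  exists 0, 0 => x; rewrite big_ord0 addr0 /dotp big1// => i _.
  by rewrite mxE mul0r.
have [a [b hab]] := IH (fun j => h (widen_ord (leqnSn m) j)) (fun j => hh _).
have [a' [b' hab']] := hh ord_max.
exists (a + a'), (b + b') => x.
by rewrite big_ord_recr /= hab hab' [dotp (a + a') x]dotpC dotpDr !(dotpC x) addrACA.
Qed.

Lemma affine_function_height p (k : R) :
  affine_function (fun x => (p.2 - dotp p.1 x) * k).
Proof.
exists (- k *: p.1), (p.2 * k) => x.
by rewrite [dotp (_ *: _) x]dotpC dotpZr (dotpC x); ring.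
Qed.

End spindles.

(** * Moving the apex *)

Section apex.
Context {R : realType} {n : nat}.
Implicit Types (B : set 'rV[R]_n) (f x y z : 'rV[R]_n) (p : 'rV[R]_n * R).

(** The affine map fixing the hyperplane [dotp p.1 x = p.2] pointwise and
    sending [f] to [f']. *)
Definition apex_map p f f' x :=
  x + ((p.2 - dotp p.1 x) / (p.2 - dotp p.1 f)) *: (f' - f).

Lemma apex_map_spin B p f f' z t x : dotp p.1 f < p.2 -> spin B f p z t x ->
  apex_map p f f' x = x + (1 - t) *: (f' - f).
Proof.
move=> fp /spin_height h; rewrite /apex_map h mulfK//.
by rewrite gt_eqF// subr_gt0.
Qed.

Lemma apex_mapK p f f' x : dotp p.1 f < p.2 -> dotp p.1 f' < p.2 ->
  apex_map p f' f (apex_map p f f' x) = x.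
Proof.
move=> fp f'p; rewrite /apex_map dotpDr dotpZr dotpBr.
apply/rowP => i; rewrite !mxE; field.
by rewrite !gt_eqF ?subr_gt0.
Qed.

(** The map is the identity plus a rank-one map along [f' - f]; its determinant
    is the inverse of the quotient below, which concerns preimages. *)
Lemma scales_vol_apex_map p f f' : dotp p.1 f < p.2 -> dotp p.1 f' < p.2 ->
  scales_vol (apex_map p f f') ((p.2 - dotp p.1 f) / (p.2 - dotp p.1 f')).
Proof.
move=> fp f'p; have fp0 : 0 < p.2 - dotp p.1 f by rewrite subr_gt0.
have f'p0 : 0 < p.2 - dotp p.1 f' by rewrite subr_gt0.
pose v := (p.2 - dotp p.1 f)^-1 *: (f' - f).
have vE : 1 - dotp p.1 v = (p.2 - dotp p.1 f') / (p.2 - dotp p.1 f).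
  by rewrite /v dotpZr dotpBr; field; rewrite gt_eqF.
have [/existsP[i pi]|] := boolP [exists i, p.1 0 i != 0]; last first.
  rewrite negb_exists => /forallP p0.
  have dotp0 x : dotp p.1 x = 0.
    rewrite /dotp big1// => i _.
    by have := p0 i; rewrite negbK => /eqP ->; rewrite mul0r.
  move: fp0 f'p0; rewrite /apex_map !dotp0 subr0 => p2 _.
  rewrite divff ?gt_eqF//; have := scales_vol_translation (f' - f).
  congr (scales_vol _ _); apply/funext => x.
  by rewrite dotp0 subr0 divff ?gt_eqF// scale1r.
have v0 : 1 - dotp p.1 v != 0 by rewrite vE gt_eqF// divr_gt0.
have := scales_vol_rank_one p.2 pi v0; rewrite vE invf_div gtr0_norm ?divr_gt0//.
congr (scales_vol _ _); apply/funext => x.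
by rewrite /apex_map /v scalerA.
Qed.

End apex.

(** * Volume of the lifting region modulo the lattice *)

Section lifting_region_volume.
Context {R : realType} {n : nat}.
Context (B : set 'rV[R]_n) (M : R) (f0 : 'rV[R]_n)
  (L : seq ('rV[R]_n * R))
  (cB : convex_set (B : set (convex_lmodType 'rV[R]_n)))
  (clB : closed B) (hM : forall x i, B x -> `|x 0 i| <= M)
  (BL : interior B `&` lattice = set0) (If0 : interior B f0)
  (LP : forall p, p \in L ->
    [/\ supports B p, exposed B p <> set0 & exposed B p <> B])
  (LF : forall F, face B F -> F <> set0 -> F <> B ->
    exists2 p, p \in L & F = exposed B p).
Implicit Types (f x y z w : 'rV[R]_n) (p : 'rV[R]_n * R).

Let f0_lt p : p \in L -> dotp p.1 f0 < p.2.
Proof. by move=> /LP[h _ h']; exact: interior_supports h'. Qed.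

(** A face, a lattice point on it and a translation vector: a spindle and a
    position of it modulo the lattice. *)
Let cell := ((('rV[R]_n * R) * 'rV[R]_n) * 'rV[R]_n)%type.

Let piece (k : cell) : set 'rV[R]_n :=
  [set x | cube x /\ spindle f0 (exposed B k.1.1) k.1.2 (x - k.2)].

Let cells_exist : exists K : seq cell,
  (forall k, k \in K -> [/\ k.1.1 \in L, lattice k.1.2,
     exposed B k.1.1 k.1.2 & lattice k.2]) /\
  (forall p z w, p \in L -> lattice z -> exposed B p z -> lattice w ->
     (forall i, `|w 0 i| <= M + 1) -> (p, z, w) \in K).
Proof.
have [Zs [ZL hZ]] := lattice_finite (n := n) M.
have [Ws [WL hW]] := lattice_finite (n := n) (M + 1).
exists [seq (pz, w) | pz <- [seq pz <- [seq (p, z) | p <- L, z <- Zs] |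
  `[< exposed B pz.1 pz.2 >]], w <- Ws]; split.
  move=> _ /allpairsP[[[p z] w] /= [+ ww ->]] /=.
  rewrite mem_filter => /andP[/asboolP Fz /allpairsP[[p' z'] /= [pL zZ e]]].
  case: e Fz => -> -> /= Fz.
  by split; [|exact: ZL| |exact: WL].
move=> p z w pL Lz Fz Lw hw; apply: (allpairs_f (fun a b => (a, b))); last exact: hW.
rewrite mem_filter; apply/andP; split; first exact/asboolP.
apply: (allpairs_f (fun a b => (a, b))) => //; apply: hZ => // i.
by have [Bz _] := Fz; exact: hM.
Qed.

Let K := sval (cid cells_exist).

Let KP k : k \in K -> [/\ k.1.1 \in L, lattice k.1.2,
     exposed B k.1.1 k.1.2 & lattice k.2].
Proof. by have [h _] := svalP (cid cells_exist); exact: h. Qed.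

Let K_mem p z w : p \in L -> lattice z -> exposed B p z -> lattice w ->
     (forall i, `|w 0 i| <= M + 1) -> (p, z, w) \in K.
Proof. by have [_ h] := svalP (cid cells_exist); exact: h. Qed.

Let k_ j := nth ((0, 0), 0, 0) K j.
Let p_ j := (k_ j).1.1.
Let z_ j := (k_ j).1.2.
Let w_ j := (k_ j).2.
Let m := size K.

Let kP j : (j < m)%N -> [/\ p_ j \in L, lattice (z_ j),
   exposed B (p_ j) (z_ j) & lattice (w_ j)].
Proof. by move=> jm; apply: KP; exact: mem_nth. Qed.

(** The pieces depend on [f0] only, so their volumes are constants. *)
Let X := seqDU (fun j => piece (k_ j)).

Let msX j : (j < m)%N -> mset (X j).
Proof.
have mp i : (i < m)%N -> mset (piece (k_ i)).
  move=> /kP[_ _ Fz _]; apply: msetI; first exact: mset_cube.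
  have [g1 _] := scales_vol_translation (- w_ i).
  by apply: g1; exact: mset_spindle clB hM Fz.
move=> jm; apply: msetD; first exact: mp.
rewrite -(bigcup_mkord _ (fun i => piece (k_ i))) /mset preimage_bigcup.
apply: fin_bigcup_measurable => //.
by move=> i /= ij; apply: mp; exact: ltn_trans jm.
Qed.

Let X_piece j x : X j x -> piece (k_ j) x.
Proof. by case. Qed.

Let X_disjoint i j x : X i x -> X j x -> i = j.
Proof.
move=> Xi Xj; apply: (@trivIset_seqDU _ (fun j => piece (k_ j)) i j) => //.
by exists x.
Qed.

Let X_cover j x : (j < m)%N -> piece (k_ j) x -> exists2 i, (i < m)%N & X i x.
Proof.
move=> jm px; have : (\bigcup_(i in `I_m) piece (k_ i)) x by exists j.
rewrite (bigcup_mkord _ (fun i => piece (k_ i)))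
    (bigsetU_seqDU (fun i => piece (k_ i))) -(bigcup_mkord _ X) => -[i im Xi].
by exists i.
Qed.

Let piece_spin j x : (j < m)%N -> piece (k_ j) x ->
  exists t, spin B f0 (p_ j) (z_ j) t (x - w_ j).
Proof.
move=> /kP[pL _ Fz _] [_ Sx]; apply: spindle_spin Sx => //; exact: f0_lt.
Qed.

(** Proportional to the distance from [f] to the hyperplane of the face: moving
    the apex from [f0] to [f] multiplies the volume of [X j] by
    [coef j f / coef j f0]. *)
Let coef j f := (p_ j).2 - dotp (p_ j).1 f.
Let volume_fun f := \sum_(j < m) coef j f * (fine (vol (X j)) / coef j f0).

Section apex_fixed.
Context (f : 'rV[R]_n) (Bf : B f).

Let visible j := dotp (p_ j).1 f < (p_ j).2.

(** From the spindle of apex [f] back to the reference piece. *)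
Let unmove j y := apex_map (p_ j) f f0 y + w_ j.
Let D j := unmove j @^-1` X j.

Let coef_invisible j : (j < m)%N -> ~~ visible j -> coef j f = 0.
Proof.
move=> /kP[/LP[h _ _] _ _ _]; rewrite /visible /coef -leNgt => h'.
by apply/eqP; rewrite subr_eq0 eq_le h' h.
Qed.

Let msD j : (j < m)%N -> visible j -> mset (D j).
Proof.
move=> jm vj; have [pL _ _ _] := kP jm.
have [g1 _] := scales_vol_comp (scales_vol_translation (w_ j))
  (scales_vol_apex_map vj (f0_lt pL)).
exact: g1 _ (msX jm).
Qed.

Let vol_fin_X j : (j < m)%N -> vol (X j) \is a fin_num.
Proof.
move=> jm; rewrite ge0_fin_numE ?measure_ge0//.
apply: (@vol_bounded_fin _ _ _ 1 (msX jm)) => x i /X_piece[cx _].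
by have /andP[h1 h2] := cx i; rewrite ger0_norm// ltW.
Qed.

Let vol_D j : (j < m)%N -> visible j ->
  vol (D j) = (coef j f * (fine (vol (X j)) / coef j f0))%:E.
Proof.
move=> jm vj; have [pL _ _ _] := kP jm.
have [_ g2] := scales_vol_comp (scales_vol_translation (w_ j))
  (scales_vol_apex_map vj (f0_lt pL)).
rewrite [LHS](g2 _ (msX jm)) mul1r -[X in (_ * X)%E]fineK ?vol_fin_X// -EFinM.
by congr (_%:E); rewrite /coef mulrAC mulrA mulrAC.
Qed.

Let D_spin j y : (j < m)%N -> visible j -> D j y -> exists t,
  spin B f (p_ j) (z_ j) t y /\ unmove j y = y + (1 - t) *: (f0 - f) + w_ j.
Proof.
move=> jm vj /X_piece/(piece_spin jm)[t]; rewrite /unmove addrK => ht.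
have [pL _ _ _] := kP jm.
have hs : spin B f (p_ j) (z_ j) t y.
  rewrite -(apex_mapK y vj (f0_lt pL)) (apex_map_spin _ (f0_lt pL) ht).
  exact: spin_move.
by exists t; split => //; rewrite (apex_map_spin _ vj hs).
Qed.

Let flip z (y : 'rV[R]_n) := -1 *: y + (z + f).

Let flip_scales z : scales_vol (flip z) 1.
Proof.
have N1 : -1 != 0 :> R by rewrite oppr_eq0 oner_neq0.
have := scales_vol_comp (scales_vol_translation (z + f)) (scales_vol_homothety N1).
by rewrite invrN invr1 normrN normr1 expr1n mulr1.
Qed.

(** The points [y] for which [z + f - y] is on the boundary of [B], where
    [spin_collision] says nothing. *)
Let bad : set 'rV[R]_n :=
  \bigcup_(j in `I_m) (flip (z_ j) @^-1` (B `\` interior B)).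

Let msBI : mset (B `\` interior B).
Proof. by apply: msetD; [exact: mset_closed|exact: mset_interior]. Qed.

Let ms_bad : mset bad.
Proof.
rewrite /mset preimage_bigcup; apply: fin_bigcup_measurable => [|j _]; first exact: finite_II.
by have [h _] := flip_scales (z_ j); exact: h _ msBI.
Qed.

Let vol_bad : vol bad = 0%E.
Proof.
apply/eqP; rewrite eq_le measure_ge0 andbT.
have S0 : (\sum_(j \in `I_m) vol (flip (z_ j) @^-1` (B `\` interior B)))%E = 0%E.
  rewrite fsbig1// => j _; have [_ h] := flip_scales (z_ j).
  by rewrite h// mul1e (vol_boundary clB cB If0 hM).
rewrite -S0 volE /bad preimage_bigcup; apply: content_sub_fsum.
- exact: finite_II.
- move=> j _; have [h _] := flip_scales (z_ j); exact: h _ msBI.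
- exact: ms_bad.
- by [].
Qed.

Let interior_not_bad j t y : (j < m)%N -> spin B f (p_ j) (z_ j) t y -> ~ bad y ->
  interior B (z_ j + f - y).
Proof.
move=> jm hs nb; apply: contrapT => nI; apply: nb; exists j; first exact: jm.
rewrite /flip /= scaleN1r addrC; split => //.
by have [_] := spin_in cB Bf hs.
Qed.

(** The moved pieces are disjoint and embedded modulo the lattice: equal heights
    mean equal displacements, so moving back preserves lattice differences, and
    the pieces [X] lie in a single unit cube. *)
Let D_collision i j y y' : (i < m)%N -> (j < m)%N -> visible i -> visible j ->
  (D i `\` bad) y -> (D j `\` bad) y' -> lattice (y' - y) -> i = j /\ y = y'.
Proof.
move=> im jm vi vj [Dy nby] [Dy' nby'] Ly.
have [t [ht uy]] := D_spin im vi Dy.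
have [t' [ht' uy']] := D_spin jm vj Dy'.
have [_ Lzi _ Lwi] := kP im; have [_ Lzj _ Lwj] := kP jm.
have tt' : t = t'.
  apply/eqP; rewrite eq_le; apply/andP; split.
    exact: spin_collision cB BL Bf ht ht' Lzi Ly (interior_not_bad im ht nby).
  have Ly' : lattice (y - y') by rewrite -opprB; exact: latticeN.
  exact: spin_collision cB BL Bf ht' ht Lzj Ly' (interior_not_bad jm ht' nby').
have [ci _] := X_piece Dy; have [cj _] := X_piece Dy'.
have uu : unmove i y = unmove j y'.
  apply: cube_lattice_eq => //; rewrite uy uy' tt'.
  rewrite (_ : _ - _ = (w_ i - w_ j) - (y' - y)).
    by apply: latticeB => //; exact: latticeB.
  by apply/rowP => l; rewrite !mxE; ring.
have Dy2 : X j (unmove i y) by rewrite uu.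
have ij : i = j by exact: X_disjoint Dy Dy2.
split => //; move: uu; rewrite uy uy' tt' -ij => /addIr/addIr.
by [].
Qed.

(** Where the spindles over the faces containing [f] lie. *)
Let invisible_faces : set 'rV[R]_n :=
  \bigcup_(p in [set` [seq p <- L | dotp p.1 f == p.2]]) exposed B p.

Let ms_invisible : mset invisible_faces.
Proof.
by apply: mset_bigcup_seq => p _; apply: mset_closed; exact: closed_exposed.
Qed.

Let vol_invisible : vol invisible_faces = 0%E.
Proof.
apply/eqP; rewrite eq_le measure_ge0 andbT.
set Li := [seq p <- L | dotp p.1 f == p.2].
have S0 : (\sum_(p \in [set` Li]) vol (exposed B p))%E = 0%E.
  rewrite fsbig1// => p /=; rewrite mem_filter => /andP[_ pL].
  have mE : mset (exposed B p) by apply: mset_closed; exact: closed_exposed.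
  apply: (vol_null_subset mE (mset_hyperplane p.1 p.2)); first by move=> x [].
  apply: vol_hyperplane; apply/eqP => p0.
  have [_ /eqP/set0P[x [_ px]] _] := LP pL.
  have dotp0 (y : 'rV[R]_n) : dotp p.1 y = 0.
    by rewrite /dotp big1// => i _; rewrite p0 mxE mul0r.
  by have := f0_lt pL; move: px => /= <-; rewrite !dotp0 ltxx.
rewrite -S0 volE /invisible_faces preimage_bigcup.
apply: content_sub_fsum => //; first exact: finite_seq.
  by move=> p _; apply: mset_closed; exact: closed_exposed.
Qed.

Let N := (bad `&` B) `|` invisible_faces.

Let msB : mset B. Proof. exact: mset_closed. Qed.

Let N_B x : N x -> B x.
Proof. by move=> [[]//|[p _ []]]. Qed.

Let msN : mset N.
Proof. by apply: msetU => //; exact: msetI. Qed.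

Let vol_N : vol N = 0%E.
Proof.
apply/eqP; rewrite eq_le measure_ge0 andbT -[0%E]adde0.
rewrite -[X in (_ <= X + _)%E]vol_bad -[X in (_ <= _ + X)%E]vol_invisible.
apply: (@le_trans _ _ (vol (bad `|` invisible_faces))).
  apply: le_vol => //; first exact: msetU.
  by apply: setSU; exact: subIsetl.
exact: measureU2.
Qed.

Let bound_N x i : N x -> `|x 0 i| <= M.
Proof. by move=> /N_B; exact: hM. Qed.

Let modN_null : mset (mod_lattice N) /\ vol (mod_lattice N) = 0%E.
Proof.
split; first exact: (mset_mod_lattice msN bound_N).
exact: (vol_mod_lattice_null msN bound_N vol_N).
Qed.

Let G j := if visible j then mod_lattice (D j `\` bad) else set0.

Let bound_D j x i : (j < m)%N -> visible j -> (D j `\` bad) x -> `|x 0 i| <= M.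
Proof.
move=> jm vj [/(D_spin jm vj)[t [/(spin_in cB Bf)[Bx _] _]] _]; exact: hM.
Qed.

Let msG j : (j < m)%N -> mset (G j).
Proof.
move=> jm; rewrite /G; case: ifPn => vj; last exact: mset0.
apply: (@mset_mod_lattice _ _ _ M); first by apply: msetD => //; exact: msD.
by move=> x i; exact: bound_D.
Qed.

Let vol_G j : (j < m)%N -> vol (G j) = (coef j f * (fine (vol (X j)) / coef j f0))%:E.
Proof.
move=> jm; rewrite /G; case: ifPn => vj; last first.
  by rewrite coef_invisible// mul0r volE preimage_set0 measure0.
have mDb : mset (D j `\` bad) by apply: msetD => //; exact: msD.
rewrite (@vol_mod_lattice_inj _ _ _ M)//; first last.
- by move=> x y hx hy Lxy; have [] := D_collision jm jm vj vj hy hx Lxy.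
- by move=> x i; exact: bound_D.
rewrite -vol_D// (volDI (msD jm vj) ms_bad).
rewrite [X in (_ + X)%E](_ : _ = 0%E) ?adde0//.
apply: (vol_null_subset _ ms_bad) => [|x []//|]; last exact: vol_bad.
by apply: msetI; [exact: msD|exact: ms_bad].
Qed.

Let A := \bigcup_(j in `I_m) G j.

Let vol_A : vol A = (volume_fun f)%:E.
Proof.
rewrite /A vol_fin_bigcup//; last first.
  move=> i j y im jm; rewrite /G; case: ifPn => // vi; case: ifPn => // vj.
  move=> /mod_latticeP[_ [x Dx Lx]] /mod_latticeP[_ [x' Dx' Lx']].
  have Lxx : lattice (x' - x).
    rewrite (_ : x' - x = (y - x) - (y - x')); first exact: latticeB.
    by apply/rowP => l; rewrite !mxE; ring.
  by have [] := D_collision im jm vi vj Dx Dx' Lxx.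
rewrite /volume_fun -fsbig_ord -sumEFin; apply: eq_bigr => j _.
exact: vol_G.
Qed.

Let region := lifting_region B f.

Let regionP x : region x <-> exists p z,
  [/\ p \in L, exposed B p z, lattice z & spindle f (exposed B p) z x].
Proof.
split=> [[F [hF F0 FB] [z [Fz Lz] Sx]]|[p [z [pL Fz Lz Sx]]]].
  have [p pL FE] := LF hF F0 FB.
  by exists p, z; rewrite -FE.
have [h1 h2 h3] := LP pL.
exists (exposed B p); last by exists z.
by split => //; exists p.1, p.2.
Qed.

Let region_B x : region x -> B x.
Proof.
move=> /regionP[p [z [pL Fz Lz [Cx _]]]]; move: x Cx; apply: conv_min => //.
by move=> x [->//|[]].
Qed.

Let ms_region : mset region.
Proof.
have [Zs [ZL hZ]] := lattice_finite (n := n) M.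
rewrite (_ : region = \bigcup_(p in [set` L])
    \bigcup_(z in [set` [seq z <- Zs | `[< exposed B p z >]]])
      spindle f (exposed B p) z).
  apply: mset_bigcup_seq => p pL; apply: mset_bigcup_seq => z.
  rewrite mem_filter => /andP[/asboolP Fz _].
  exact: mset_spindle clB hM Fz.
apply/seteqP; split => [x /regionP[p [z [pL Fz Lz Sx]]]|x [p pL [z + Sx]]].
  exists p => //; exists z => //=; rewrite mem_filter; apply/andP; split.
    exact/asboolP.
  by apply: hZ => // i; have [Bz _] := Fz; exact: hM.
rewrite /= mem_filter => /andP[/asboolP Fz zZ]; apply/regionP.
by exists p, z; split => //; exact: ZL.
Qed.

Let A_region : A `<=` mod_lattice region.
Proof.
move=> y [j /= jm]; rewrite /G; case: ifPn => // vj.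
move=> /mod_latticeP[cy [x [Dx _] Lx]]; apply/mod_latticeP; split => //.
exists x => //; apply/regionP; have [pL Lz Fz _] := kP jm.
exists (p_ j), (z_ j); split => //.
by have [t [/(spin_spindle cB)]] := D_spin jm vj Dx.
Qed.

(** A point of the region of [f] is moved to the region of [f0], reduced to the
    unit cube, located in a piece [X j], possibly over another face, and moved
    back by the map of that piece.  As heights agree the result differs from
    the initial point by a lattice vector. *)
Let region_A : mod_lattice region `<=` A `|` mod_lattice N.
Proof.
move=> y /mod_latticeP[cy [x /regionP[p [z [pL Fz Lz Sx]]] Lx]].
have [fp|] := ltP (dotp p.1 f) p.2; last first.
  move=> fp; right; apply/mod_latticeP; split => //; exists x => //; right.
  have [hp _ _] := LP pL.
  have fpE : dotp p.1 f = p.2 by apply/eqP; rewrite eq_le fp hp.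
  exists p; first by rewrite /= mem_filter fpE eqxx.
  have [Cx _] := Sx; move: x Cx {Sx Lx}; apply: conv_min.
    exact: convex_exposed.
  by move=> x [->//|].
have [t ht] := spindle_spin cB fp Fz Sx.
pose x1 := x + (1 - t) *: (f0 - f).
have ht1 : spin B f0 p z t x1 by exact: spin_move.
have Bf0 := interior_subset If0.
have [Bx1 _] := spin_in cB Bf0 ht1.
have /frac_partP[cc Lc] := erefl (frac_part x1).
set c := frac_part x1 in cc Lc.
have wK : (p, z, c - x1) \in K.
  apply: K_mem => // i; have := hM i Bx1; have /andP[] := cc i.
  by rewrite !mxE !ler_norml => h1 h2 /andP[h3 h4]; apply/andP; split; lra.
pose k1 : cell := (p, z, c - x1).
have km : (index k1 K < m)%N by rewrite index_mem.
have [j jm Xj] : exists2 j, (j < m)%N & X j c.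
  apply: X_cover km _; rewrite /piece /k_ nth_index//=; split => //.
  by rewrite subKr; exact: spin_spindle ht1.
have [t' ht'] := piece_spin jm (X_piece Xj).
have [pjL Lzj Fzj Lwj] := kP jm.
have Ld : lattice (c - w_ j - x1) by rewrite addrAC; exact: latticeB.
have Ld' : lattice (x1 - (c - w_ j)) by rewrite -opprB; exact: latticeN.
have tt' : t' = t.
  apply/eqP; rewrite eq_le; apply/andP; split.
    exact: spin_collision_interior cB BL If0 ht' ht1 Lzj Ld'.
  exact: spin_collision_interior cB BL If0 ht1 ht' Lz Ld.
rewrite tt' in ht'.
pose x2 := c - w_ j + (1 - t) *: (f - f0).
have ht2 : spin B f (p_ j) (z_ j) t x2 by exact: spin_move.
have Ly : lattice (y - x2).
  rewrite (_ : y - x2 = (y - x) - (c - w_ j - x1)); first exact: latticeB.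
  by rewrite /x2 /x1; apply/rowP => l; rewrite !mxE; ring.
have [Bx2 _] := spin_in cB Bf ht2.
have [vj|nvj] := boolP (visible j); last first.
  right; apply/mod_latticeP; split => //; exists x2 => //; right.
  have [hp _ _] := LP pjL.
  have fpE : dotp (p_ j).1 f = (p_ j).2.
    by apply/eqP; rewrite eq_le hp// leNgt.
  exists (p_ j); first by rewrite /= mem_filter fpE eqxx.
  split => //=; have := spin_height ht2; rewrite fpE subrr mulr0.
  by move/eqP; rewrite subr_eq0 => /eqP.
have [bx2|nbx2] := pselect (bad x2).
  by right; apply/mod_latticeP; split => //; exists x2 => //; left.
left; exists j => //; rewrite /G vj; apply/mod_latticeP; split => //.
exists x2 => //; split => //.
rewrite /D /= /unmove (apex_map_spin _ vj ht2) (_ : _ + w_ j = c)//.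
by rewrite /x2; apply/rowP => l; rewrite !mxE; ring.
Qed.

Lemma vol_region_apex : vol (mod_lattice region) = (volume_fun f)%:E.
Proof.
have mY : mset (mod_lattice region).
  by apply: (@mset_mod_lattice _ _ _ M) => // x i /region_B; exact: hM.
have mA : mset A.
  rewrite /mset preimage_bigcup; apply: fin_bigcup_measurable => [|j]; first exact: finite_II.
  exact: msG.
have [mN N0] := modN_null.
rewrite (volDI mY mA) (_ : _ `&` A = A); last exact/setIidPr.
rewrite vol_A [X in (X + _)%E](_ : _ = 0%E) ?add0e//.
apply: (vol_null_subset _ mN) => //; first exact: msetD.
by move=> x [/region_A[]].
Qed.

End apex_fixed.

Lemma vol_lifting_region_affine : exists g : 'rV[R]_n -> R, affine_function g /\
  forall f, B f -> vol (mod_lattice (lifting_region B f)) = (g f)%:E.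
Proof.
exists volume_fun; split; last by move=> f Bf; exact: vol_region_apex.
apply: affine_function_sum => j; exact: affine_function_height.
Qed.

End lifting_region_volume.

Theorem theorem3p4 (R : realType) (n : nat) (B : set 'rV[R]_n)
    (hB : maximal_lattice_free B) (hP : polytope B) :
  exists g : 'rV[R]_n -> R, affine_function g /\
    forall f, B f -> vol (mod_lattice (lifting_region B f)) = (g f)%:E.
Proof.
have [[fullB clB cB BL] _] := hB.
have [M _ hM] := polytope_bounded hP.
have [f0 If0] := interior_polytope hP fullB.
have [L [LP LF]] := finite_faces hP.
exact: (@vol_lifting_region_affine _ _ _ M f0 L).
Qed.
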